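(* Let $\gamma\subset\mathbb{R}^d$ be a rectifiable curve of length $l$, and let $R>0$ be such that for any $p\in B_R(\gamma)$ there exists a unique $t\in[0,\mathcal{H}^1(\gamma)]$ with $|p-\gamma(t)|=\operatorname{dist}(p,\gamma)$. Then for every non-decreasing function $\varphi:[0,+\infty)\to[0,+\infty)$ the curve $\gamma$ is a solution of the average distance minimizing problem for $\Omega=B_R(\gamma)$, $\varphi$ and $l$.
   Context: $\mathcal{H}^1$ is the one-dimensional Hausdorff measure. For a set $T\subset\mathbb{R}^d$, $B_R(T)=\bigcup_{x\in T}B_R(x)$ is the open $R$-neighbourhood of $T$, where $B_R(x)$ is the open ball. For a rectifiable curve $\gamma\subset\mathbb{R}^d$, by abuse of notation $\gamma:[0,\mathcal{H}^1(\gamma)]\to\mathbb{R}^d$ also denotes its arc length parametrization. Average distance minimizing problem: given a non-decreasing function $\varphi:[0,+\infty)\to[0,+\infty)$, a bounded open set $\Omega\subset\mathbb{R}^d$ and a real number $l>0$, minimize $$\int_\Omega\varphi(\operatorname{dist}(x,\beta))\,dx$$ over all compact connected subsets $\beta$ contained in $\overline{\Omega}$ with $\mathcal{H}^1(\beta)\le l$. A solution is an admissible set attaining the minimum. *)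

(* Defs.v *)
From HB Require Import structures.
From mathcomp Require Import all_boot all_order all_algebra.
From mathcomp Require Import all_classical all_reals all_analysis.
From mathcomp Require Import measurable_realfun.

Set Implicit Arguments.
Unset Strict Implicit.
Unset Printing Implicit Defensive.

Import Order.TTheory GRing.Theory Num.Theory.
Import numFieldNormedType.Exports.

Local Open Scope classical_set_scope.
Local Open Scope ring_scope.

(* Points of R^d are row vectors 'rV[R]_d. Their library norm is the sup norm:
   it induces the usual topology (used for open, closure, compact, connected),
   but distances, balls, diameters and lengths below are all Euclidean. *)

Section euclidean.
Context {R : realType} {d : nat}.
Implicit Types (x y : 'rV[R]_d) (T : set 'rV[R]_d).

Definition enorm x : R := Num.sqrt (\sum_(i < d) x ord0 i ^+ 2).

Definition eball x (r : R) : set 'rV[R]_d := [set y | enorm (y - x) < r].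

Definition nbhd T (r : R) : set 'rV[R]_d := \bigcup_(x in T) eball x r.

(* Only meaningful for T nonempty: the infimum of the empty set is 0. *)
Definition dist x T : R := inf [set enorm (x - y) | y in T].

(* The element 0 makes the diameter of the empty set 0 instead of -oo. *)
Definition diam T : \bar R :=
  ereal_sup (0%E |` [set (enorm (z.1 - z.2))%:E | z in T `*` T]).

Definition hausdorff1_pre (delta : R) T : \bar R :=
  ereal_inf [set (\sum_(0 <= i <oo) diam (U i))%E | U in
    [set U : nat -> set 'rV[R]_d |
      T `<=` \bigcup_i U i /\ forall i, (diam (U i) <= delta%:E)%E]].

(* No normalizing constant is needed in dimension one. *)
Definition hausdorff1 T : \bar R :=
  ereal_sup [set hausdorff1_pre delta T | delta in [set delta : R | 0 < delta]].

(* Vector-valued version of the library's total variation of a real function. *)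
Definition curve_length (a b : R) (f : R -> 'rV[R]_d) : \bar R :=
  ereal_sup [set (let F := f \o nth b (a :: s) in
                  \sum_(0 <= n < size s) enorm (F n.+1 - F n))%:E
            | s in itv_partition a b].

Definition rectifiable_curve T : Prop :=
  exists (a b : R) (f : R -> 'rV[R]_d),
    [/\ a <= b, {within `[a, b], continuous f},
        (curve_length a b f < +oo)%E & T = f @` `[a, b]].

Definition arc_length_parametrization T (g : R -> 'rV[R]_d) : Prop :=
  T = g @` `[0, fine (hausdorff1 T)] /\
  forall s t, 0 <= s -> s <= t -> t <= fine (hausdorff1 T) ->
    curve_length s t g = (t - s)%:E.

End euclidean.

(* Lebesgue measure on R^d: iterated product of the one-dimensional Lebesgue
   measure, carried over to row vectors with their Borel sigma-algebra. *)

Section lebesgue_tuple.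
Context {R : realType}.

Local Notation M := (measurableTypeR R).

Section step.
Variables (n : nat) (mu : {sigma_finite_measure set (n.-tuple M) -> \bar R}).

Definition consp (p : M * n.-tuple M) : n.+1.-tuple M :=
  [the n.+1.-tuple M of p.1 :: p.2].

Lemma measurable_consp : measurable_fun setT consp.
Proof. exact: measurable_cons. Qed.

Lemma measurable_uncons :
  measurable_fun setT
    (fun t : n.+1.-tuple M => (thead t, [tuple of behead t] : n.-tuple M)).
Proof.
apply: measurable_fun_pair; last exact: measurable_behead.
exact: (measurable_tnth (T := M) ord0).
Qed.

Definition lebesgue_tuple_step : set (n.+1.-tuple M) -> \bar R :=
  pushforward (@lebesgue_measure R \x mu)%E consp.

Let step0 : lebesgue_tuple_step set0 = 0%E.
Proof. by rewrite /lebesgue_tuple_step /pushforward preimage_set0 measure0. Qed.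

Let step_ge0 A : (0 <= lebesgue_tuple_step A)%E.
Proof. by have mf := measurable_consp; exact: measure_ge0. Qed.

Let step_sigma_additive : semi_sigma_additive lebesgue_tuple_step.
Proof.
have mf := measurable_consp; exact: measure_semi_sigma_additive.
Qed.

HB.instance Definition _ := isMeasure.Build _ _ _ lebesgue_tuple_step
  step0 step_ge0 step_sigma_additive.

Let step_sigma_finite : sigma_finite setT lebesgue_tuple_step.
Proof.
have /sigma_finiteP[F [FT ndF Foo]] := sigma_finiteT (@lebesgue_measure R).
have /sigma_finiteP[G [GT ndG Goo]] := sigma_finiteT mu.
pose u (t : n.+1.-tuple M) := (thead t, [tuple of behead t] : n.-tuple M).
have consK : u \o consp = id.
  by apply/funext => -[x t]; rewrite /u /= theadE; congr pair; apply/val_inj.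
exists (fun k => u @^-1` (F k `*` G k)).
  apply/esym; rewrite -subTset => t _.
  have : setT (u t).1 by []. rewrite FT => -[i _ Fi].
  have : setT (u t).2 by []. rewrite GT => -[j _ Gj].
  exists (maxn i j) => //; split.
    by move: Fi; exact/subsetPset/ndF/leq_maxl.
  by move: Gj; exact/subsetPset/ndG/leq_maxr.
move=> k; have [mF Fk] := Foo k; have [mG Gk] := Goo k; split.
  rewrite -[X in measurable X]setTI; apply: measurable_uncons => //.
  exact: measurableX.
rewrite /lebesgue_tuple_step /pushforward -comp_preimage consK preimage_id.
by rewrite product_measure1E// lte_mul_pinfty// ge0_fin_numE.
Qed.

HB.instance Definition _ := Measure_isSigmaFinite.Build _ _ _
  lebesgue_tuple_step step_sigma_finite.

End step.

Fixpoint lebesgue_tuple n : {sigma_finite_measure set (n.-tuple M) -> \bar R} :=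
  match n with
  | 0 => \d_ ([tuple] : 0.-tuple M)
  | n'.+1 => lebesgue_tuple_step (lebesgue_tuple n')
  end.

End lebesgue_tuple.

Arguments consp {R n} p.

Section lebesgue_rV.
Context {R : realType} (d : nat).

Local Notation M := (measurableTypeR R).

Definition borel_rV := g_sigma_algebraType (@open 'rV[R]_d).

Definition row_of_tuple (t : d.-tuple M) : borel_rV :=
  (\row_(i < d) (tnth t i : R)) : 'rV[R]_d.

Let measurable_preimage_ball (x : 'rV[R]_d) (e : R) :
  0 < e -> measurable (row_of_tuple @^-1` (ball x e)).
Proof.
move=> e0.
rewrite (_ : _ @^-1` _ =
    \bigcap_(i in [set: 'I_d]) ((fun t => tnth t i) @^-1` ball (x ord0 i) e)).
  apply: fin_bigcap_measurable => [|i _]; first exact: finite_finset.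
  rewrite -[X in measurable X]setTI; apply: measurable_tnth => //.
  exact: measurable_ball.
apply/seteqP; split => [t [_ xt] i _|t xt] /=.
  by have := xt ord0 i; rewrite mxE.
by split => // i j; rewrite ord1 mxE; exact: xt.
Qed.

Lemma measurable_row_of_tuple : measurable_fun setT row_of_tuple.
Proof.
apply: measurability; [exact: (@erefl _ (@measurable _ borel_rV))|move=> _ [U oU <-]].
rewrite setTI.
pose I := ('rV[rat]_d * nat)%type.
pose B (k : I) : set 'rV[R]_d := ball (map_mx ratr k.1 : 'rV[R]_d) k.2.+1%:R^-1.
have -> : U = \bigcup_(k in [set k : I | B k `<=` U]) B k.
  apply/seteqP; split => [x Ux|x [k kU Bx]]; last exact: kU.
  have /nbhs_ballP[e /= e0 eU] : nbhs x U by exact: open_nbhs_nbhs.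
  have [k ke] : exists k : nat, k.+1%:R^-1 < e / 2.
    have /archi_boundP : 0 <= (e / 2)^-1 by rewrite invr_ge0 divr_ge0// ltW.
    set k := Num.bound _ => ek; exists k.
    rewrite -[ltRHS]invrK ltf_pV2 ?posrE ?invr_gt0 ?divr_gt0//.
    by apply: lt_trans ek _; rewrite ltr_nat.
  have k0 : 0 < k.+1%:R^-1 :> R by rewrite invr_gt0.
  have /choice[q qx] : forall i, exists q : rat,
      ball (x ord0 i) (k.+1%:R^-1) (ratr q : R).
    move=> i.
    have /rat_in_itvoo[q] : x ord0 i - k.+1%:R^-1 < x ord0 i + k.+1%:R^-1.
      by rewrite ltrBlDr -addrA ltrDl addr_gt0.
    rewrite in_itv/= => xq; exists q.
    by rewrite /ball /= ltr_distlC.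
  have xB : B (\row_i q i, k) x.
    split => // i j; rewrite ord1 !mxE; apply: ball_sym; exact: qx.
  exists (\row_i q i, k) => //= y By; apply: eU.
  rewrite [e]splitr; apply: (@ball_triangle _ _ (map_mx ratr (\row_i q i) : 'rV[R]_d)).
    by apply: ball_sym; apply: le_ball xB; exact: ltW.
  by apply: le_ball By; exact: ltW.
rewrite preimage_bigcup bigcup_mkcond.
apply: countable_bigcupT_measurable => [|k]; first exact: countableP.
by case: ifP => // _; apply: measurable_preimage_ball; rewrite invr_gt0.
Qed.

Definition lebesgue_rV : set borel_rV -> \bar R :=
  pushforward (lebesgue_tuple d) row_of_tuple.

Let rV0 : lebesgue_rV set0 = 0%E.
Proof. by rewrite /lebesgue_rV /pushforward preimage_set0 measure0. Qed.

Let rV_ge0 A : (0 <= lebesgue_rV A)%E.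
Proof. by have mf := measurable_row_of_tuple; exact: measure_ge0. Qed.

Let rV_sigma_additive : semi_sigma_additive lebesgue_rV.
Proof.
have mf := measurable_row_of_tuple; exact: measure_semi_sigma_additive.
Qed.

HB.instance Definition _ := isMeasure.Build _ _ _ lebesgue_rV
  rV0 rV_ge0 rV_sigma_additive.

End lebesgue_rV.

Arguments lebesgue_rV {R} d _.

Section average_distance.
Context {R : realType} {d : nat}.
Implicit Types (phi : R -> R) (Omega beta gamma : set 'rV[R]_d) (l : R).

Definition average_distance phi Omega beta : \bar R :=
  (\int[lebesgue_rV d]_(x in Omega) (phi (dist x beta))%:E)%E.

Definition admissible Omega l beta : Prop :=
  [/\ beta !=set0, compact beta, connected beta, beta `<=` closure Omega &
      (hausdorff1 beta <= l%:E)%E].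

Definition adm_solution phi Omega l gamma : Prop :=
  admissible Omega l gamma /\
  forall beta, admissible Omega l beta ->
    (average_distance phi Omega gamma <= average_distance phi Omega beta)%E.

End average_distance.

(* Main.v *)
Require Import Defs.
From HB Require Import structures.
From mathcomp Require Import all_boot all_order all_algebra.
From mathcomp Require Import all_classical all_reals all_analysis.
From mathcomp Require Import measurable_realfun ring lra.

Import Order.TTheory GRing.Theory Num.Theory.
Import numFieldNormedType.Exports.

Local Open Scope classical_set_scope.
Local Open Scope ring_scope.

(** Write [B_s(T)] for [nbhd T s]. It is enough to show that, for every [s <= r],
    [B_s(Gamma)] has at least the volume of [B_s(beta)] for every admissible
    [beta]. Indeed, inside [B_r(Gamma)] the sublevel sets of a non-decreasing
    function of the distance are then larger for [Gamma] than for [beta], and the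
    layer cake formula [le_integral_superlevel] compares the two integrals.

    Let [V] be the volume of a ball of radius [s], and let [cap s p q] be the
    volume that the ball around [q] adds to the ball around [p]. Because Lebesgue
    measure is invariant under translations and reflections, a cap depends on the
    distance between [p] and [q] alone; and because balls are convex, it is
    monotone and subadditive in that distance ([cap_scale]).

    Lower bound for the curve. The heart of the proof is
    [ball_trace_connected]: the parameters [t] with [gamma t] in a given ball of
    radius [s <= r] form an interval. If [gamma b] were outside the ball around
    [p] while the nearest point of the curve lay before [b] and some [gamma t'] of
    the ball after [b], then moving from [p] straight to [gamma t'] the nearest
    parameter would travel from one side of [b] to the other. By uniqueness it
    passes through [b], and the triangle inequality puts [gamma b] into the ball.
    Consequently the ball around a new point of the curve meets the tube around
    its past only inside the ball around the last point visited, so the tube gains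
    a whole cap at each step of an inscribed polygon. Refining the polygons yields
    [tube_slope]: no cap exceeds [c] times the distance of its centres, where
    [V + c * l] is the volume of [B_s(Gamma)].

    Upper bound for a competitor. By [continuum_tree], a continuum of measure at
    most [l] is approximated by finite trees that are hardly longer than [l]. An
    edge of a tree adds at most the cap of its end points, hence at most [c] times
    its length ([vol_tree]). In the limit [B_s(beta)] has volume at most
    [V + c * l], the volume of [B_s(Gamma)]. *)

(** * Euclidean norm, neighbourhoods and distance *)

Section euclidean_norm.
Context {R : realType} {d : nat}.
Implicit Types (x y v : 'rV[R]_d) (T : set 'rV[R]_d) (c r : R).

Definition dot x y : R := \sum_(i < d) x ord0 i * y ord0 i.

Lemma dotC x y : dot x y = dot y x.
Proof. by apply: eq_bigr => i _; rewrite mulrC. Qed.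

Lemma dotDl x y v : dot (x + y) v = dot x v + dot y v.
Proof.
by rewrite -big_split/=; apply: eq_bigr => i _; rewrite !mxE mulrDl.
Qed.

Lemma dotZl c x y : dot (c *: x) y = c * dot x y.
Proof. by rewrite mulr_sumr; apply: eq_bigr => i _; rewrite !mxE mulrA. Qed.

Lemma dotDr x y v : dot v (x + y) = dot v x + dot v y.
Proof. by rewrite dotC dotDl !(dotC v). Qed.

Lemma dotZr c x y : dot x (c *: y) = c * dot x y.
Proof. by rewrite dotC dotZl dotC. Qed.

Lemma dot_ge0 x : 0 <= dot x x.
Proof. by apply: sumr_ge0 => i _; rewrite -expr2 sqr_ge0. Qed.

Lemma enormE x : enorm x = Num.sqrt (dot x x).
Proof. by congr Num.sqrt; apply: eq_bigr => i _; rewrite expr2. Qed.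

Lemma enorm_ge0 x : 0 <= enorm x.
Proof. exact: sqrtr_ge0. Qed.

Lemma enorm_sqr x : enorm x ^+ 2 = dot x x.
Proof. by rewrite enormE sqr_sqrtr// dot_ge0. Qed.

Lemma enormZ c x : enorm (c *: x) = `|c| * enorm x.
Proof.
by rewrite !enormE dotZl dotZr mulrA -expr2 sqrtrM ?sqr_ge0// sqrtr_sqr.
Qed.

Lemma enormN x : enorm (- x) = enorm x.
Proof. by rewrite -scaleN1r enormZ normrN1 mul1r. Qed.

Lemma enormB x y : enorm (x - y) = enorm (y - x).
Proof. by rewrite -enormN opprB. Qed.

Lemma enorm0 : enorm (0 : 'rV[R]_d) = 0.
Proof. by rewrite -(scale0r (0 : 'rV[R]_d)) enormZ normr0 mul0r. Qed.

Lemma coord_le_enorm x i : `|x ord0 i| <= enorm x.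
Proof.
rewrite -sqrtr_sqr ler_wsqrtr// (bigD1 i)//= lerDl.
by apply: sumr_ge0 => j _; rewrite sqr_ge0.
Qed.

Lemma enorm_eq0 x : enorm x = 0 -> x = 0.
Proof.
move=> x0; apply/rowP => i; rewrite mxE; apply/eqP; rewrite -normr_le0 -x0.
exact: coord_le_enorm.
Qed.

Lemma dot_le x y : dot x y <= enorm x * enorm y.
Proof.
have [/eqP x0|x0] := boolP (enorm x == 0).
  by rewrite x0 (enorm_eq0 x x0) mul0r -(scale0r (0 : 'rV[R]_d)) dotZl mul0r.
have [/eqP y0|y0] := boolP (enorm y == 0).
  by rewrite y0 (enorm_eq0 y y0) mulr0 -(scale0r (0 : 'rV[R]_d)) dotZr mul0r.
have xp : 0 < enorm x by rewrite lt_def x0 enorm_ge0.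
have yp : 0 < enorm y by rewrite lt_def y0 enorm_ge0.
have := dot_ge0 (enorm y *: x - enorm x *: y).
rewrite -scaleNr !(dotDl, dotDr, dotZl, dotZr) -!enorm_sqr (dotC y x).
set a := enorm x; set b := enorm y; set D := dot x y => h.
have h2 : 0 <= (a * b) * (a * b - D) by nra.
by rewrite -subr_ge0; move: h2; rewrite pmulr_rge0// mulr_gt0.
Qed.

Lemma enormD x y : enorm (x + y) <= enorm x + enorm y.
Proof.
rewrite -ler_sqr ?nnegrE ?addr_ge0 ?enorm_ge0//.
rewrite enorm_sqr dotDl !dotDr (dotC y x) -!enorm_sqr.
have := dot_le x y; nra.
Qed.

Lemma enorm_triangle x y v : enorm (x - v) <= enorm (x - y) + enorm (y - v).
Proof.
by have := enormD (x - y) (y - v); rewrite addrA subrK.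
Qed.

(** Euclidean balls are open because the topology comes from the sup norm, and the
    two norms are equivalent. *)
Lemma enorm_le_norm x : enorm x <= d%:R * `|x|.
Proof.
have le1 i : `|x ord0 i| <= `|x|.
  rewrite [leRHS]/Num.norm/= mx_normrE.
  exact: (le_bigmax _ (fun ij : 'I_1 * 'I_d => `|x ij.1 ij.2|) (ord0, i)).
rewrite -ler_sqr ?nnegrE ?enorm_ge0 ?mulr_ge0// enorm_sqr /dot.
apply: (@le_trans _ _ (\sum_(i < d) `|x| ^+ 2)).
  by apply: ler_sum => i _; rewrite -expr2 -real_normK ?num_real// ler_sqr ?nnegrE.
rewrite sumr_const card_ord exprMn -[leLHS]mulr_natl ler_wpM2r ?sqr_ge0//.
by rewrite -natrX ler_nat; case: (d) => // n; rewrite expnS expn1 leq_pmulr.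
Qed.


Lemma enorm_triangle_le x y v a b :
  enorm (x - y) <= a -> enorm (y - v) <= b -> enorm (x - v) <= a + b.
Proof. by move=> xa yb; apply: le_trans (enorm_triangle x y v) (lerD xa yb). Qed.

Lemma eballC x y r : eball x r y = eball y r x.
Proof. by rewrite /eball/= enormB. Qed.

Lemma open_eball x r : open (eball x r).
Proof.
rewrite openE => y yr; rewrite /interior; apply/nbhs_ballP.
exists ((r - enorm (y - x)) / d.+1%:R) => /=.
  by rewrite divr_gt0// subr_gt0.
move=> z yz; rewrite /eball/=.
apply: le_lt_trans (enorm_triangle z y x) _; rewrite -ltrBrDr.
apply: le_lt_trans (enorm_le_norm _) _.
move: yz; rewrite -ball_normE /ball_/= distrC => zy.
have {zy} : `|z - y| < (r - enorm (y - x)) / d.+1%:R by exact: zy.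
rewrite ltr_pdivlMr// mulrC; apply: le_lt_trans.
by rewrite ler_wpM2r// ler_nat.
Qed.

Lemma open_nbhd T r : open (nbhd T r).
Proof. by apply: bigcup_open => x _; exact: open_eball. Qed.

Lemma nbhdS T S r : T `<=` S -> nbhd T r `<=` nbhd S r.
Proof. by move=> TS x [y Ty yx]; exists y => //; exact: TS. Qed.

Lemma nbhd_nbhd T r e : nbhd (nbhd T r) e `<=` nbhd T (r + e).
Proof.
move=> x [y [z Tz zy] yx]; exists z => //; rewrite /eball/= (addrC r).
exact: le_lt_trans (enorm_triangle x y z) (ltrD yx zy).
Qed.

Lemma le_nbhd T r e : r <= e -> nbhd T r `<=` nbhd T e.
Proof. by move=> re x [y Ty yx]; exists y => //; exact: lt_le_trans re. Qed.

Lemma sub_nbhd T r : 0 < r -> T `<=` nbhd T r.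
Proof. by move=> r0 x Tx; exists x => //; rewrite /eball/= subrr enorm0. Qed.

Lemma nbhd1 x r : nbhd [set x] r = eball x r.
Proof. by rewrite /nbhd bigcup_set1. Qed.

Lemma nbhdU T S r : nbhd (T `|` S) r = nbhd T r `|` nbhd S r.
Proof. exact: bigcup_setU. Qed.

Lemma has_inf_dist x T : T !=set0 -> has_inf [set enorm (x - y) | y in T].
Proof.
move=> [y Ty]; split; first by exists (enorm (x - y)), y.
by exists 0 => _ [z _ <-]; exact: enorm_ge0.
Qed.

Lemma dist_ge0 x T : 0 <= dist x T.
Proof.
have [->|/set0P T0] := eqVneq T set0; first by rewrite /dist image_set0 inf0.
apply: lb_le_inf; first by have [] := has_inf_dist x T T0.
by move=> _ [z _ <-]; exact: enorm_ge0.
Qed.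

Lemma dist_le x y T : T y -> dist x T <= enorm (x - y).
Proof.
move=> Ty; apply: ge_inf; last by exists y.
by have [] := has_inf_dist x T (ex_intro _ y Ty).
Qed.

Lemma dist_lt x T r : T !=set0 -> (dist x T < r) <-> nbhd T r x.
Proof.
move=> T0; split=> [|[y Ty yx]]; last by apply: le_lt_trans (dist_le x y T Ty) _.
by case/(inf_lt (has_inf_dist x T T0).1) => _ [y Ty <-] ?; exists y.
Qed.

Lemma dist_lip x y T : T !=set0 -> dist x T <= enorm (x - y) + dist y T.
Proof.
move=> T0; apply/ler_addgt0Pr => e e0.
have /(dist_lt y T _ T0)[z Tz zy] : dist y T < dist y T + e by rewrite ltrDl.
apply: le_trans (dist_le x z T Tz) _.
rewrite -addrA; exact: enorm_triangle_le (lexx _) (ltW zy).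
Qed.

End euclidean_norm.

Section reflection.
Context {R : realType} {d : nat}.
Implicit Types (x y v : 'rV[R]_d).

(** The reflections replace the whole orthogonal group: a reflection along
    [x - y] exchanges two given vectors [x] and [y] of equal norm, and being an
    involution it needs no separate inverse. *)
(* When [v = 0] the coefficient is [0] and the reflection is the identity. *)
Definition reflect v x : 'rV[R]_d := x - (2 * dot x v / dot v v) *: v.

Lemma reflectD v x y : reflect v (x + y) = reflect v x + reflect v y.
Proof.
by rewrite /reflect dotDl mulrDr mulrDl scalerDl opprD addrACA.
Qed.

Lemma reflectN v x : reflect v (- x) = - reflect v x.
Proof.
by rewrite /reflect -(scaleN1r x) dotZl scaleN1r mulN1r mulrN mulNr scaleNr
  opprK opprB addrC.
Qed.

Lemma dot_self_neq0 v : dot v v != 0 \/ v = 0.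
Proof.
have [/eqP v0|] := boolP (dot v v == 0); [right|by left].
by apply: enorm_eq0; rewrite enormE v0 sqrtr0.
Qed.

Lemma reflectK v : involutive (reflect v).
Proof.
move=> x; have [v0|->] := dot_self_neq0 v; last by rewrite /reflect !scaler0 !subr0.
set c := 2 * dot x v / dot v v.
have cE : 2 * dot (reflect v x) v / dot v v = - c.
  rewrite /reflect -/c -scaleNr dotDl dotZl /c.
  by move: (dot x v) (dot v v) v0 => a b b0; field.
by rewrite {1}/reflect cE scaleNr opprK /reflect subrK.
Qed.

Lemma enorm_reflect v x : enorm (reflect v x) = enorm x.
Proof.
have [v0|->] := dot_self_neq0 v; last by rewrite /reflect !scaler0 !subr0.
rewrite !enormE; congr Num.sqrt; rewrite /reflect -scaleNr.
rewrite !(dotDl, dotDr, dotZl, dotZr) (dotC v x).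
by move: (dot x v) (dot v v) (dot x x) v0 => a b e b0; field.
Qed.

Lemma reflect_swap x y : enorm x = enorm y -> reflect (x - y) x = y.
Proof.
move=> /(congr1 (fun t => t ^+ 2)); rewrite !enorm_sqr => xy.
have [v0|] := dot_self_neq0 (x - y); last first.
  by move=> h; rewrite h /reflect scaler0 subr0; apply/eqP; rewrite -subr_eq0 h.
have c1 : 2 * dot x (x - y) / dot (x - y) (x - y) = 1.
  apply: (mulIf v0); rewrite divfK// mul1r.
  rewrite -scaleN1r !(dotDl, dotDr, dotZl, dotZr) xy (dotC y x).
  by move: (dot x y) (dot y y) => a b; ring.
by rewrite /reflect c1 scale1r opprB addrCA subrr addr0.
Qed.

End reflection.

(** * Lebesgue measure on tuples *)

Lemma measurable_preimage d1 d2 (T1 : measurableType d1) (T2 : measurableType d2)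
    (f : T1 -> T2) (A : set T2) :
  measurable_fun setT f -> measurable A -> measurable (f @^-1` A).
Proof. by move=> mf mA; rewrite -(setTI (f @^-1` A)); exact: mf. Qed.

Section lebesgue_tuple_invariance.
Context {R : realType}.
Local Notation M := (measurableTypeR R).

Lemma lebesgue_measure_shift (a : R) (A : set R) : measurable A ->
  lebesgue_measure ((fun x : M => (x + a : M)) @^-1` A) = lebesgue_measure A.
Proof.
have mf : measurable_fun [set: M] (fun x : M => (x + a : M)).
  exact: measurable_funD.
move=> mA; apply/esym.
apply: (@lebesgue_measure_unique _
  (measure_function_pushforward__canonical__measure_function_Measure lebesgue_measure mf))
  => //= _ [[x y]] _ <-.
rewrite /pushforward (_ : _ @^-1` _ = `]x - a, y - a]%classic); last first.
  by apply/seteqP; split=> z /=; rewrite !in_itv/= ltrBlDr lerBrDr.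
by rewrite !lebesgue_measure_itv/= !lte_fin ltrD2r -!EFinB opprB addrA subrK.
Qed.

Definition tshift n (v t : n.-tuple M) : n.-tuple M :=
  [tuple (tnth t i + tnth v i : M) | i < n].

Lemma measurable_tshift n (v : n.-tuple M) : measurable_fun setT (tshift n v).
Proof.
apply/measurable_fun_tnthP => i.
rewrite (_ : _ \o _ = fun t : n.-tuple M => (tnth t i + tnth v i : M)).
  apply: measurable_funD => //; exact: measurable_tnth.
by apply/funext => t /=; rewrite tnth_mktuple.
Qed.

(** By induction on the dimension: the translated product measure agrees with the
    product measure on rectangles. *)
Lemma lebesgue_tuple_shift n (v : n.-tuple M) (A : set (n.-tuple M)) :
  measurable A -> lebesgue_tuple n (tshift n v @^-1` A) = lebesgue_tuple n A.
Proof.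
elim: n v A => [|n IH] v A mA.
  congr (_ _); apply/seteqP; split=> t /=; by rewrite (tuple0 (tshift _ _ _)) (tuple0 t).
rewrite /= /lebesgue_tuple_step /pushforward.
pose v' : n.-tuple M := [tuple of behead v].
pose g (p : M * n.-tuple M) : M * n.-tuple M := ((p.1 + thead v : M), tshift n v' p.2).
have mg : measurable_fun setT g.
  apply: measurable_fun_pair.
    by apply: measurable_funD => //; exact: measurable_fst.
  exact: measurableT_comp (measurable_tshift _ _) measurable_snd.
have -> : consp @^-1` (tshift n.+1 v @^-1` A) = g @^-1` (consp @^-1` A).
  have E p : tshift n.+1 v (consp p) = consp (g p).
    apply: eq_from_tnth => i; rewrite tnth_mktuple.
    case: (unliftP ord0 i) => [j ->|->]; last by rewrite !tnth0.
    rewrite !tnthS tnth_mktuple tnth_behead; congr (_ + tnth v _).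
    by apply: val_inj; rewrite /= inordK// ltnS; exact: ltn_ord.
  by apply/funext => p; rewrite /preimage/= E.
have mcA : measurable (consp @^-1` A).
  exact: (measurable_preimage _ _ _ _ _ _ (@measurable_consp R n) mA).
rewrite [RHS](@product_measure_unique _ _ _ _ _ _ _
  (measure_function_pushforward__canonical__measure_function_Measure
    (lebesgue_measure \x lebesgue_tuple n)%E mg))//.
move=> B C mB mC /=; rewrite /pushforward.
have -> : g @^-1` (B `*` C) =
  ((fun x : M => (x + thead v : M)) @^-1` B) `*` (tshift n v' @^-1` C) by [].
have m1 : measurable ((fun x : M => (x + thead v : M)) @^-1` B).
  by apply: measurable_preimage => //; exact: measurable_funD.
have m2 := measurable_preimage _ _ _ _ _ _ (measurable_tshift n v') mC.
rewrite (@product_measure1E _ _ _ _ _ _ _ _ _ m1 m2) IH//; congr (_ * _)%E.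
exact: lebesgue_measure_shift.
Qed.

Lemma lebesgue_tupleT n : (0 < lebesgue_tuple n [set: n.-tuple M])%E.
Proof.
elim: n => [|n IH] /=; first by rewrite diracT lte01.
rewrite /lebesgue_tuple_step /pushforward preimage_setT -setXTT.
have RT : (@lebesgue_measure R) setT = +oo%E.
  by rewrite -set_itvNyy lebesgue_measure_itv.
by rewrite product_measure1E// [X in (_ < X * _)%E]RT gt0_mulye// ltry.
Qed.

Definition tcube n (k : R) : set (n.-tuple M) :=
  [set t | forall i, `|tnth t i| <= k].

Lemma measurable_tcube n k : measurable (tcube n k).
Proof.
rewrite (_ : tcube n k = \bigcap_(i in [set: 'I_n])
    ((fun t : n.-tuple M => tnth t i) @^-1` `[-k, k])).
  apply: fin_bigcap_measurable => [|i _]; first exact: finite_finset.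
  by apply: measurable_preimage => //; exact: measurable_tnth.
apply/seteqP; split=> [t tk i _|t tk i] /=.
  by rewrite in_itv/= -ler_norml.
by have := tk i I; rewrite /= in_itv/= -ler_norml.
Qed.

Lemma lebesgue_tcube n k : (lebesgue_tuple n (tcube n k) < +oo)%E.
Proof.
elim: n => [|n IH] /=; first by rewrite diracE; case: (_ \in _); rewrite ?ltry.
rewrite /lebesgue_tuple_step /pushforward.
have -> : consp @^-1` (tcube n.+1 k) = `[-k, k] `*` tcube n k.
  apply/seteqP; split=> [[x t] xk|[x t] /= [xk tk] i].
    split => [|i] /=; first by rewrite in_itv/= -ler_norml; have := xk ord0; rewrite tnth0.
    by have := xk (lift ord0 i); rewrite /consp/= tnthS.
  case: (unliftP ord0 i) => [j ->|->]; first by rewrite tnthS.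
  by move: xk; rewrite tnth0 in_itv/= -ler_norml.
rewrite product_measure1E//; last exact: measurable_tcube.
rewrite lte_mul_pinfty//.
by rewrite [X in X \is a fin_num]lebesgue_measure_itv/=; case: ifP.
Qed.

End lebesgue_tuple_invariance.

(** * Isometry invariance of Lebesgue measure *)

(** The two iterated integrals are measures that agree on rectangles. *)
Lemma cavalieri d1 d2 (T1 : measurableType d1) (T2 : measurableType d2)
    (R : realType) (m1 : {sigma_finite_measure set T1 -> \bar R})
    (m2 : {sigma_finite_measure set T2 -> \bar R}) (E : set (T1 * T2)) :
  measurable E ->
  (\int[m1]_x m2 (xsection E x) = \int[m2]_y m1 (ysection E y))%E.
Proof.
move=> mE; apply: (@product_measure_unique _ _ _ _ _ m1 m2 (m1 \x^ m2)%E) => //.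
by move=> A B mA mB; exact: product_measure2E.
Qed.

Section lebesgue_rV_invariance.
Context {R : realType} {d : nat}.
Local Notation M := (measurableTypeR R).
Local Notation T := (d.-tuple M).
Local Notation mu := (lebesgue_tuple d : {sigma_finite_measure set T -> \bar R}).

Definition tuple_of_row (x : 'rV[R]_d) : T := [tuple (x ord0 i : M) | i < d].

Lemma tuple_of_rowK x : row_of_tuple (tuple_of_row x) = x.
Proof. by apply/rowP => i; rewrite mxE tnth_mktuple. Qed.

Lemma measurable_tuple_of_row d' (X : measurableType d') (f : X -> 'rV[R]_d) :
  (forall i, measurable_fun setT (fun x => f x ord0 i : M)) ->
  measurable_fun setT (fun x => tuple_of_row (f x)).
Proof.
move=> mf; apply/measurable_fun_tnthP => i.
rewrite (_ : _ \o _ = fun x => f x ord0 i : M)//.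
by apply/funext => x /=; rewrite tnth_mktuple.
Qed.

Lemma measurable_coord i : measurable_fun setT (fun t : T => row_of_tuple t ord0 i : M).
Proof.
rewrite (_ : (fun _ => _) = fun t : T => tnth t i); first exact: measurable_tnth.
by apply/funext => t; rewrite mxE.
Qed.

Lemma measurable_reflect_coord v i :
  measurable_fun setT (fun t : T => reflect v (row_of_tuple t) ord0 i : M).
Proof.
rewrite (_ : (fun _ => _) = fun t : T => row_of_tuple t ord0 i +
   (\sum_(j < d) row_of_tuple t ord0 j * v ord0 j) * (- (2 / dot v v * v ord0 i))).
  apply: measurable_funD; first exact: measurable_coord.
  apply: measurable_funM => //; apply: measurable_sum => j.
  by apply: measurable_funM => //; exact: measurable_coord.
by apply/funext => t; rewrite /reflect !mxE /dot; ring.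
Qed.

Lemma lebesgue_rV_shift (v : 'rV[R]_d) (A : set (borel_rV d)) : measurable A ->
  lebesgue_rV d ((fun x : 'rV[R]_d => x + v) @^-1` A) = lebesgue_rV d A.
Proof.
move=> mA; rewrite /lebesgue_rV /pushforward.
rewrite -(lebesgue_tuple_shift d (tuple_of_row v) (@row_of_tuple R d @^-1` A)); last first.
  exact: (measurable_preimage _ _ _ _ _ _ (@measurable_row_of_tuple R d) mA).
congr (_ _); apply/funext => t; rewrite /preimage/=; congr (A _).
by apply/rowP => i; rewrite !mxE !tnth_mktuple.
Qed.

Lemma measurable_nbhd (K : set 'rV[R]_d) r :
  measurable (nbhd K r : set (borel_rV d)).
Proof. by apply: sub_sigma_algebra; exact: open_nbhd. Qed.

Lemma measurable_eball (x : 'rV[R]_d) r :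
  measurable (eball x r : set (borel_rV d)).
Proof. by rewrite -nbhd1; exact: measurable_nbhd. Qed.

Lemma lebesgue_rV_bounded (A : set (borel_rV d)) (k : R) : measurable A ->
  A `<=` eball 0 k -> (lebesgue_rV d A < +oo)%E.
Proof.
move=> mA Ak; apply: le_lt_trans (lebesgue_tcube d k).
rewrite /lebesgue_rV /pushforward; apply: le_measure; rewrite ?inE.
- exact: (measurable_preimage _ _ _ _ _ _ (@measurable_row_of_tuple R d) mA).
- exact: measurable_tcube.
- move=> t /Ak; rewrite /eball/= subr0 => tk i.
  have := coord_le_enorm (row_of_tuple t) i; rewrite mxE => /le_trans; apply.
  exact: ltW.
Qed.

Lemma eball_bigcup : \bigcup_(n : nat) eball (0 : 'rV[R]_d) n%:R = setT.
Proof.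
apply/seteqP; split=> // x _; exists (Num.bound (enorm x)) => //.
by rewrite /eball/= subr0 archi_boundP// enorm_ge0.
Qed.

Lemma lebesgue_rV_eball_gt0 : exists n : nat,
  (0 < lebesgue_rV d (eball (0 : 'rV[R]_d) n%:R))%E.
Proof.
apply: contrapT => /forallNP B0.
have : (lebesgue_rV d (\bigcup_(n : nat) (eball (0 : 'rV[R]_d) n%:R : set (borel_rV d)))
    <= 0)%E.
  apply: le_trans (measure_sigma_subadditive _ _ _ (@subset_refl _ _)) _.
  - by move=> n; exact: measurable_eball.
  - by apply: bigcup_measurable => n _; exact: measurable_eball.
  - rewrite eseries0// => n _ _; apply/eqP; rewrite eq_le measure_ge0 andbT.
    by rewrite leNgt; exact/negP/B0.
apply/negP; rewrite -ltNge [X in lebesgue_rV d X]eball_bigcup.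
by rewrite /lebesgue_rV /pushforward preimage_setT lebesgue_tupleT.
Qed.

(** Haar's uniqueness argument, which avoids a change of variables formula. Let
    [A] be a ball around the origin. The set of pairs [(x, y)] with [A x] and
    [B (reflect v x + y)] has slices of measure [mu B] over [A]. Translating its
    slices at fixed [y] by [- reflect v y] gives the set of pairs with
    [A (x - reflect v y)] and [B (reflect v x)], whose slices at fixed [x] have
    measure [mu A], because [A] is symmetric and invariant under the reflection. *)
Lemma lebesgue_rV_reflect (v : 'rV[R]_d) (B : set (borel_rV d)) : measurable B ->
  lebesgue_rV d (reflect v @^-1` B) = lebesgue_rV d B.
Proof.
move=> mB.
have [n A0] := lebesgue_rV_eball_gt0.
set A := eball (0 : 'rV[R]_d) n%:R in A0.
have mA : measurable (A : set (borel_rV d)) by exact: measurable_eball.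
have Aoo : (lebesgue_rV d A < +oo)%E by exact: (lebesgue_rV_bounded A n%:R mA).
have Arefl x : A (reflect v x) = A x by rewrite /A /eball/= !subr0 enorm_reflect.
have AN x : A (- x) = A x by rewrite /A /eball/= !subr0 enormN.
have Aswap x y : A (x - reflect v y) = A (y - reflect v x).
  by rewrite -Arefl reflectD reflectN reflectK -AN opprB.
pose row : T -> borel_rV d := @row_of_tuple R d.
have mrow : measurable_fun setT row := @measurable_row_of_tuple R d.
have mpre (f : T * T -> 'rV[R]_d) (C : set (borel_rV d)) : measurable C ->
    (forall i, measurable_fun setT (fun p => f p ord0 i : M)) ->
    measurable [set p | C (f p)].
  move=> mC /measurable_tuple_of_row mf.
  have -> : [set p | C (f p)] = (fun p => tuple_of_row (f p)) @^-1` (row @^-1` C).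
    by apply/funext => p; rewrite /preimage/= /row tuple_of_rowK.
  by do 2 apply: measurable_preimage => //.
have mfst i : measurable_fun setT (fun p : T * T => row p.1 ord0 i : M).
  exact: measurableT_comp (measurable_coord i) measurable_fst.
have msnd i : measurable_fun setT (fun p : T * T => row p.2 ord0 i : M).
  exact: measurableT_comp (measurable_coord i) measurable_snd.
have mrfst i : measurable_fun setT (fun p : T * T => reflect v (row p.1) ord0 i : M).
  exact: measurableT_comp (measurable_reflect_coord v i) measurable_fst.
have mrsnd i : measurable_fun setT (fun p : T * T => reflect v (row p.2) ord0 i : M).
  exact: measurableT_comp (measurable_reflect_coord v i) measurable_snd.
pose E : set (T * T) := [set p | A (row p.1)] `&` [set p | B (reflect v (row p.1) + row p.2)].
pose F : set (T * T) := [set p | A (row p.1 - reflect v (row p.2))] `&`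
   [set p | B (reflect v (row p.1))].
have mE : measurable E.
  apply: measurableI; apply: mpre => // i.
  rewrite (_ : (fun _ => _) = fun p => reflect v (row p.1) ord0 i + row p.2 ord0 i).
    by apply: measurable_funD; [exact: mrfst|exact: msnd].
  by apply/funext => p; rewrite mxE.
have mF : measurable F.
  apply: measurableI; apply: mpre => // i.
  rewrite (_ : (fun _ => _) = fun p => row p.1 ord0 i - reflect v (row p.2) ord0 i).
    by apply: measurable_funB; [exact: mfst|exact: mrsnd].
  by apply/funext => p; rewrite !mxE.
have slices y : mu (ysection E y) = mu (ysection F y).
  rewrite -(lebesgue_tuple_shift d (tuple_of_row (- reflect v (row y)))); last first.
    exact: measurable_ysection.
  have rowshift t u : row (tshift d (tuple_of_row u) t) = row t + u.
    by apply/rowP => i; rewrite !mxE !tnth_mktuple.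
  congr (_ _); apply/seteqP; split=> t; rewrite /ysection/= !inE /E /F/= !rowshift;
    by rewrite reflectD reflectN reflectK subrK.
have : (\int[mu]_x mu (xsection E x) = \int[mu]_x mu (xsection F x))%E.
  by rewrite !cavalieri//; apply: eq_integral => y _; exact: slices.
rewrite (eq_integral (fun t => lebesgue_rV d B * (\1_(row @^-1` A) t)%:E)%E); last first.
  move=> t _; rewrite indicE; have [At|At] := boolP (t \in row @^-1` A).
    rewrite mule1 -(lebesgue_rV_shift (reflect v (row t)))//.
    congr (_ _); apply/seteqP; split=> u; rewrite /xsection/= inE /E/= addrC.
      by case.
    by split => //; rewrite inE in At.
  rewrite mule0 (_ : xsection _ _ = set0) ?measure0// -subset0 => u.
  by rewrite /xsection/= inE => -[/= At' _]; apply: (negP At); apply/mem_set.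
rewrite [in RHS](eq_integral
    (fun t => lebesgue_rV d A * (\1_(row @^-1` (reflect v @^-1` B)) t)%:E)%E); last first.
  move=> t _; rewrite indicE; have [Bt|Bt] := boolP (t \in row @^-1` (reflect v @^-1` B)).
    rewrite mule1 -(lebesgue_rV_shift (- reflect v (row t)))//.
    congr (_ _); apply/seteqP; split=> u; rewrite /xsection/= inE /F/= -/(row u).
      by case; rewrite Aswap.
    split; last by rewrite inE in Bt.
    by rewrite Aswap.
  rewrite mule0 (_ : xsection _ _ = set0) ?measure0// -subset0 => u.
  by rewrite /xsection/= inE => -[/= _ Bt']; apply: (negP Bt); apply/mem_set.
have mrA : measurable (row @^-1` A) by exact: measurable_preimage.
have mrB : measurable (row @^-1` (reflect v @^-1` B)).
  have -> : row @^-1` (reflect v @^-1` B) =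
      (fun t => tuple_of_row (reflect v (row t))) @^-1` (row @^-1` B).
    by apply/funext => t; rewrite /preimage/= /row tuple_of_rowK.
  apply: measurable_preimage; last exact: measurable_preimage.
  by apply: measurable_tuple_of_row => i; exact: measurable_reflect_coord.
rewrite !ge0_integralZl//; last 2 first.
- by apply/measurable_EFinP; exact: measurable_indic.
- by apply/measurable_EFinP; exact: measurable_indic.
rewrite !integral_indic// !setIT muleC => AB.
have {}AB : (lebesgue_rV d A * lebesgue_rV d B =
  lebesgue_rV d A * lebesgue_rV d (reflect v @^-1` B))%E by exact: AB.
have Afin : lebesgue_rV d A \is a fin_num by rewrite ge0_fin_numE// ltW.
apply/eqP; rewrite eq_le -(lee_pmul2l Afin A0) AB lexx/=.
by rewrite -(lee_pmul2l Afin A0) AB lexx.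
Qed.

End lebesgue_rV_invariance.

(** * Volumes of overlapping balls *)

Section volume.
Context {R : realType} {d : nat}.
Implicit Types (A B : set 'rV[R]_d) (p q x y e : 'rV[R]_d) (s : R).

(** A real-valued volume, meaningful for sets of finite measure only. *)
Definition vol A : R := fine (lebesgue_rV d A).

Definition bounded_borel A : Prop :=
  measurable (A : set (borel_rV d)) /\ exists k, A `<=` eball 0 k.

Lemma vol_fin_num A : bounded_borel A -> lebesgue_rV d A \is a fin_num.
Proof.
by move=> [mA [k Ak]]; rewrite ge0_fin_numE// (lebesgue_rV_bounded A k mA Ak).
Qed.

Lemma volK A : bounded_borel A -> (vol A)%:E = lebesgue_rV d A.
Proof. by move=> bA; rewrite fineK// vol_fin_num. Qed.

Lemma vol_ge0 A : 0 <= vol A.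
Proof. exact: fine_ge0. Qed.

Lemma bounded_borelS A B : measurable (A : set (borel_rV d)) ->
  A `<=` B -> bounded_borel B -> bounded_borel A.
Proof. by move=> mA AB [_ [k Bk]]; split => //; exists k; exact: subset_trans Bk. Qed.

Lemma bounded_borelD A B : bounded_borel A -> bounded_borel B ->
  bounded_borel (A `\` B).
Proof.
move=> bA [mB _]; apply: (bounded_borelS _ A); [|exact: subDsetl|exact: bA].
by apply: measurableD => //; case: bA.
Qed.

Lemma bounded_borelI A B : bounded_borel A -> bounded_borel B ->
  bounded_borel (A `&` B).
Proof.
move=> bA [mB _]; apply: (bounded_borelS _ A); [|exact: subIsetl|exact: bA].
by apply: measurableI => //; case: bA.
Qed.

Lemma bounded_borelU A B : bounded_borel A -> bounded_borel B ->
  bounded_borel (A `|` B).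
Proof.
move=> [mA [k Ak]] [mB [k' Bk]]; split; first exact: measurableU.
exists (Num.max k k') => x [/Ak|/Bk]; rewrite /eball/= => /lt_le_trans; apply.
  by rewrite le_max lexx.
by rewrite le_max lexx orbT.
Qed.

Lemma bounded_borel_nbhd A s k : (A `<=` eball 0 k) -> bounded_borel (nbhd A s).
Proof.
move=> Ak; split; first exact: measurable_nbhd.
exists (k + s) => x [y /Ak yk yx]; rewrite /eball/= (addrC k).
exact: le_lt_trans (enorm_triangle x y 0) (ltrD yx yk).
Qed.

Lemma bounded_borel_eball p s : bounded_borel (eball p s).
Proof.
rewrite -nbhd1; apply: (bounded_borel_nbhd _ _ (enorm p + 1)) => _ ->.
by rewrite /eball/= subr0 ltrDl.
Qed.

Lemma le_vol A B : measurable (A : set (borel_rV d)) -> bounded_borel B ->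
  A `<=` B -> vol A <= vol B.
Proof.
move=> mA bB AB; have bA := bounded_borelS _ _ mA AB bB.
rewrite fine_le ?vol_fin_num//; apply: le_measure; rewrite ?inE//.
by case: bB.
Qed.

Lemma volU_le A B : bounded_borel A -> bounded_borel B ->
  vol (A `|` B) <= vol A + vol B.
Proof.
move=> bA bB; rewrite -lee_fin EFinD !volK//; last exact: bounded_borelU.
by apply: measureU2; [case: bA|case: bB].
Qed.

Lemma volU A B : bounded_borel A -> bounded_borel B -> A `&` B = set0 ->
  vol (A `|` B) = vol A + vol B.
Proof.
move=> bA bB AB; apply: EFin_inj; rewrite EFinD !volK//; last exact: bounded_borelU.
by apply: measureU => //; [case: bA|case: bB].
Qed.

Lemma volD A B : bounded_borel A -> bounded_borel B ->
  vol (A `\` B) = vol A - vol (A `&` B).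
Proof.
move=> bA bB; apply/eqP; rewrite eq_sym subr_eq eq_sym -volU.
- by rewrite setUC setUIDK.
- exact: bounded_borelD.
- exact: bounded_borelI.
- by apply/seteqP; split=> // x [[_ nB] [_ /nB]].
Qed.

Lemma vol_eball p s : vol (eball p s) = vol (eball 0 s).
Proof.
congr fine; rewrite -(lebesgue_rV_shift (- p) (eball 0 s)); last exact: measurable_eball.
by congr (lebesgue_rV d _); apply/funext => x; rewrite /preimage/eball/= subr0.
Qed.

Definition cap s p q := vol (eball q s `\` eball p s).

Lemma cap_ge0 s p q : 0 <= cap s p q. Proof. exact: vol_ge0. Qed.

Lemma capE s p q : cap s p q = vol (eball 0 s) - vol (eball q s `&` eball p s).
Proof. by rewrite /cap volD ?vol_eball//; exact: bounded_borel_eball. Qed.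

Lemma capxx s p : cap s p p = 0.
Proof. by rewrite capE setIid vol_eball subrr. Qed.

(** A translation brings [p] and [x] to the origin and a reflection then exchanges
    the two other centres. *)
Lemma cap_isometry s p q x y : enorm (q - p) = enorm (y - x) ->
  cap s p q = cap s x y.
Proof.
have mcap a b : measurable (eball b s `\` eball a s : set (borel_rV d)).
  by have [] := bounded_borelD _ _ (bounded_borel_eball b s) (bounded_borel_eball a s).
have shift0 a b : cap s a b = cap s 0 (b - a).
  congr fine; rewrite -(lebesgue_rV_shift (- a) (eball (b - a) s `\` eball 0 s)); last exact: mcap.
  congr (lebesgue_rV d _); apply/funext => z.
  by rewrite /preimage/setD/eball/= subr0 opprB addrA subrK.
rewrite (shift0 p) (shift0 x) => pqxy.
have /= r0 := reflect_swap _ _ pqxy; set v := _ - _ in r0.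
congr fine; rewrite -(lebesgue_rV_reflect v (eball (y - x) s `\` eball 0 s)); last exact: mcap.
congr (lebesgue_rV d _); apply/funext => z.
rewrite /preimage/setD/eball/= !subr0 enorm_reflect -r0.
by rewrite -reflectN -reflectD enorm_reflect.
Qed.

Lemma cap_triangle s p x q : cap s p q <= cap s p x + cap s x q.
Proof.
have bb := bounded_borel_eball; have bD := bounded_borelD.
apply: le_trans (volU_le _ _ (bD _ _ (bb x s) (bb p s)) (bD _ _ (bb q s) (bb x s))).
apply: le_vol; first by have [] := bD _ _ (bb q s) (bb p s).
  by apply: bounded_borelU; exact: bD.
move=> y [yq yp]; have [yx|yx] := pselect (eball x s y); first by left.
by right.
Qed.

(** A ball is convex, hence two balls on a line meet inside every ball of the
    same radius centred between them. *)
Lemma eball_convex s p q x u : 0 <= u <= 1 ->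
  eball p s x -> eball q s x -> eball (p + u *: (q - p)) s x.
Proof.
move=> /andP[u0 u1]; rewrite /eball/= => xp xq.
have -> : x - (p + u *: (q - p)) = (1 - u) *: (x - p) + u *: (x - q).
  apply/rowP => i; rewrite !mxE; ring.
apply: le_lt_trans (enormD _ _) _.
rewrite !enormZ !ger0_norm ?subr_ge0//.
have [ab|/ltW ab] := leP (enorm (x - p)) (enorm (x - q)).
  apply: le_lt_trans xq; nra.
apply: le_lt_trans xp; nra.
Qed.

Lemma le_cap_line s p e u v : 0 <= u <= v -> cap s p (p + u *: e) <= cap s p (p + v *: e).
Proof.
move=> /andP[u0 uv]; rewrite !capE lerD2l lerN2.
have bb := bounded_borel_eball; have bI := bounded_borelI.
apply: le_vol; [by have [] := bI _ _ (bb (p + v *: e) s) (bb p s)|exact: bI|].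
move=> x [xv xp]; split => //.
have [v0|v0] := eqVneq v 0.
  have -> : u = v by apply/eqP; rewrite eq_le uv v0 u0.
  by [].
have vp : 0 < v by rewrite lt_def v0 (le_trans u0).
have -> : p + u *: e = p + (u / v) *: (p + v *: e - p).
  by rewrite addrAC subrr add0r scalerA divfK.
by apply: eball_convex => //; rewrite divr_ge0 ?(ltW vp)//= ler_pdivrMr// mul1r.
Qed.

Lemma cap_chain s p e n : cap s p (p + n%:R *: e) <= n%:R * cap s 0 e.
Proof.
elim: n => [|n IH]; first by rewrite scale0r addr0 capxx mul0r.
apply: le_trans (cap_triangle s p (p + n%:R *: e) _) _.
rewrite -natr1 mulrDl mul1r lerD// (cap_isometry _ _ _ 0 e)// subr0.
by congr enorm; apply/rowP => i; rewrite !mxE; ring.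
Qed.

(** The number [n] of steps of length [enorm (y - x)] needed to get at least as far
    as [enorm (q - p)] costs one step more than the exact ratio; subadditivity
    bounds the cap of the [n] steps, monotonicity the cap at the intermediate
    point [q]. *)
Lemma cap_scale s p q x y : 0 < enorm (y - x) ->
  enorm (y - x) * cap s p q <= (enorm (q - p) + enorm (y - x)) * cap s x y.
Proof.
set h := enorm (y - x); set H := enorm (q - p) => h0.
have [H0|H0] := eqVneq H 0.
  have -> : q = p by apply/eqP; rewrite -subr_eq0; apply/eqP/enorm_eq0.
  by rewrite capxx mulr0 mulr_ge0 ?cap_ge0 ?addr_ge0 ?enorm_ge0.
have Hp : 0 < H by rewrite lt_def H0 enorm_ge0.
pose n := (Num.truncn (H / h)).+1.
have nlt : H < n%:R * h by rewrite -ltr_pdivrMr// truncnS_gt.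
have nle : n%:R * h <= H + h.
  rewrite -natr1 mulrDl mul1r lerD2r -ler_pdivlMr// truncn_le//.
  by rewrite divr_ge0// ltW.
pose e := (h / H) *: (q - p).
have eh : enorm e = h by rewrite enormZ ger0_norm ?divfK// divr_ge0// ltW.
have -> : q = p + (H / h) *: e.
  by rewrite scalerA mulrA divfK ?gt_eqF// divff ?gt_eqF// scale1r addrC subrK.
apply: (@le_trans _ _ (h * (n%:R * cap s x y))).
  rewrite ler_pM2l// (cap_isometry _ x y 0 e) ?subr0 ?eh//.
  apply: le_trans (cap_chain s p e n).
  by apply: le_cap_line; rewrite divr_ge0 ?(ltW Hp, ltW h0)//= ler_pdivrMr// ltW.
by rewrite mulrA (mulrC h) ler_wpM2r// cap_ge0.
Qed.

End volume.

(** * The tube around a unit-speed curve grows by caps *)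

Section unit_speed.
Context {R : realType} {d : nat} (g : R -> 'rV[R]_d) (l : R).
Hypothesis l_gt0 : 0 < l.
Hypothesis unit_speed : forall s t : R, 0 <= s -> s <= t -> t <= l ->
  curve_length s t g = (t - s)%:E.

Lemma chord_le (s t : R) : 0 <= s -> s <= t -> t <= l -> enorm (g t - g s) <= t - s.
Proof.
move=> s0 st tl; rewrite -lee_fin -unit_speed//.
have [->|nst] := eqVneq s t.
  by rewrite unit_speed ?(le_trans s0)// !subrr enorm0.
apply: ereal_sup_ubound; exists [:: t].
  by apply: itv_partition1; rewrite lt_neqAle nst.
by rewrite /= big_nat1.
Qed.

Lemma chord_norm_le s t : s \in `[0, l] -> t \in `[0, l] ->
  enorm (g t - g s) <= `|t - s|.
Proof.
rewrite !in_itv/= => /andP[s0 sl] /andP[t0 tl].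
have [st|ts] := leP s t; first by rewrite ger0_norm ?subr_ge0// chord_le.
by rewrite enormB ltr0_norm ?subr_lt0// opprB chord_le// ltW.
Qed.

Lemma arc_bounded t : t <= l -> g @` `[0, t] `<=` eball 0 (enorm (g 0) + l + 1).
Proof.
move=> tl _ [u /= ut <-]; rewrite /eball/= subr0.
have ul : u \in `[0, l] by move: ut; rewrite !in_itv/= => /andP[-> /le_trans ->].
have := chord_norm_le 0 u; rewrite in_itv/= lexx (ltW l_gt0) => /(_ isT ul).
rewrite subr0 ger0_norm; last by move: ul; rewrite in_itv/= => /andP[].
move: ul; rewrite in_itv/= => /andP[u0 ul] ug.
have := enormD (g u - g 0) (g 0); rewrite subrK; lra.
Qed.

Lemma chord_sum_le (c : R) (G : R -> R) (P : seq R) (a b : R) :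
  (forall x y, a <= x -> x <= y -> y <= b -> c * enorm (g y - g x) <= G y - G x) ->
  itv_partition a b P ->
  c * (let F := g \o nth b (a :: P) in
       \sum_(0 <= n < size P) enorm (F n.+1 - F n)) <= G b - G a.
Proof.
elim: P a => [|x P IH] a cG abP /=.
  by rewrite big_geq// mulr0 (itv_partition_nil abP) subrr.
have ax : a <= x by case: abP => /= /andP[/ltW].
have xb := itv_partition_le (itv_partition_cons abP).
rewrite big_nat_recl//= mulrDr.
have -> : G b - G a = (G x - G a) + (G b - G x) by ring.
apply: lerD; first exact: cG.
apply: IH; last exact: itv_partition_cons abP.
by move=> y z xy; apply: cG; exact: le_trans xy.
Qed.

(** The arc length is the supremum of the lengths of inscribed polygons, so a bound
    by the increments of [G] passes from chords to arcs. *)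
Lemma arc_length_le (c : R) (G : R -> R) (a b : R) : 0 <= c ->
  0 <= a -> a <= b -> b <= l ->
  (forall x y, a <= x -> x <= y -> y <= b -> c * enorm (g y - g x) <= G y - G x) ->
  c * (b - a) <= G b - G a.
Proof.
move=> c0 a0 ab bl cG.
have [->|cn] := eqVneq c 0.
  by rewrite mul0r; have := cG a b (lexx _) ab (lexx _); apply: le_trans; rewrite mulr_ge0 ?enorm_ge0.
have cp : 0 < c by rewrite lt_def cn.
rewrite mulrC -ler_pdivlMr// -lee_fin -unit_speed//.
apply: ge_ereal_sup => _ [P abP <-]; rewrite lee_fin ler_pdivlMr// mulrC.
exact: chord_sum_le.
Qed.

Section tube.
Variable s : R.
Hypothesis connected_trace : forall p (a b c : R), 0 <= a -> a <= b -> b <= c -> c <= l ->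
  eball p s (g a) -> eball p s (g c) -> eball p s (g b).

Definition tube t := vol (nbhd (g @` `[0, t]) s).

Lemma tube0 : tube 0 = vol (eball (0 : 'rV[R]_d) s).
Proof. by rewrite /tube set_itv1 image_set1 nbhd1 vol_eball. Qed.

(** The ball around a new point meets the tube around the past of the curve only
    inside the ball around the last visited point. *)
Lemma cap_le_tube (a b : R) : 0 <= a -> a <= b -> b <= l ->
  cap s (g a) (g b) <= tube b - tube a.
Proof.
move=> a0 ab bl.
have bN t : t <= l -> bounded_borel (nbhd (g @` `[0, t]) s).
  by move=> tl; exact: bounded_borel_nbhd (arc_bounded t tl).
have bC : bounded_borel (eball (g b) s `\` eball (g a) s).
  by apply: bounded_borelD; exact: bounded_borel_eball.
rewrite lerBrDl -volU//; last 2 first.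
- by apply: bN; exact: le_trans bl.
- apply/seteqP; split=> // x [[_ [u /= ua <-] xu] [xb xa]]; apply: xa.
  move: ua; rewrite in_itv/= => /andP[u0 ua]; rewrite eballC.
  by apply: (connected_trace x u a b) => //; rewrite eballC.
apply: le_vol; [|exact: bN|].
  by have [] := bounded_borelU _ _ (bN a (le_trans ab bl)) bC.
move=> x [|[xb _]].
  by apply: nbhdS; apply: image_subset => u /=; rewrite !in_itv/= => /andP[-> /le_trans ->].
by exists (g b) => //; exists b => //=; rewrite in_itv/= lexx andbT (le_trans a0).
Qed.

Lemma le_tube (a b : R) : 0 <= a -> a <= b -> b <= l -> tube a <= tube b.
Proof.
by move=> a0 ab bl; rewrite -subr_ge0; apply: le_trans (cap_le_tube a b a0 ab bl); exact: cap_ge0.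
Qed.

(** On arcs shorter than [eta] the tube grows at least at the rate that caps of
    width [enorm (q - p)] suggest, up to the error allowed by [cap_scale]. *)
Lemma tube_short_arc (p q : 'rV[R]_d) (eta a b : R) : 0 < eta -> 0 <= a -> a <= b -> b <= l -> b - a <= eta ->
  cap s p q * (b - a) <= (enorm (q - p) + eta) * (tube b - tube a).
Proof.
move=> eta0 a0 ab bl abeta.
rewrite [leRHS]mulrBr; apply: (arc_length_le _ (fun t => (enorm (q - p) + eta) * tube t)) => //.
  exact: cap_ge0.
move=> x y ax xy yb; rewrite /= -mulrBr.
have x0 := le_trans a0 ax; have yl := le_trans yb bl.
have txy := le_tube x y x0 xy yl.
have [h0|h0] := eqVneq (enorm (g y - g x)) 0.
  by rewrite h0 mulr0 mulr_ge0 ?subr_ge0 ?addr_ge0 ?enorm_ge0 ?(ltW eta0).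
have hp : 0 < enorm (g y - g x) by rewrite lt_def h0 enorm_ge0.
rewrite mulrC; apply: le_trans (cap_scale s p q _ _ hp) _.
apply: ler_pM; rewrite ?addr_ge0 ?enorm_ge0 ?cap_ge0 ?cap_le_tube//.
rewrite lerD2l; apply: le_trans (chord_le x y x0 xy yl) _.
by apply: le_trans abeta; rewrite lerB.
Qed.

(** Cutting the curve into [n.+1] equal arcs makes [eta] tend to zero. *)
Lemma tube_slope (p q : 'rV[R]_d) :
  l * cap s p q <= enorm (q - p) * (tube l - vol (eball (0 : 'rV[R]_d) s)).
Proof.
suff tube_n n : l * cap s p q <=
    (enorm (q - p) + l / n.+1%:R) * (tube l - vol (eball (0 : 'rV[R]_d) s)).
  apply/ler_addgt0Pr => e e0.
  set D := tube l - _ in tube_n *.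
  have D0 : 0 <= D by rewrite subr_ge0 -tube0 le_tube// ltW.
  have lDe : 0 <= l * D / e by rewrite divr_ge0 ?mulr_ge0// ltW.
  apply: le_trans (tube_n (Num.bound (l * D / e))) _.
  rewrite mulrDl lerD2l mulrAC ler_pdivrMr// (mulrC e) -ler_pdivrMr//.
  by apply: le_trans (ltW (archi_boundP lDe)) _; rewrite ler_nat.
have eta0 : 0 < l / n.+1%:R by rewrite divr_gt0.
pose t k := k%:R * (l / n.+1%:R).
have step k : (k <= n.+1)%N -> cap s p q * t k <=
    (enorm (q - p) + l / n.+1%:R) * (tube (t k) - tube 0).
  elim: k => [|k IH] kn; first by rewrite /t !mul0r subrr !mulr0.
  have tS : t k.+1 - t k = l / n.+1%:R by rewrite /t -mulrBl -natr1 addrC addKr mul1r.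
  have t0 : 0 <= t k by rewrite mulr_ge0// ltW.
  have := tube_short_arc p q (l / n.+1%:R) (t k) (t k.+1) eta0 t0.
  rewrite tS lexx => /(_ _ _ isT).
  have -> : t k <= t k.+1 by rewrite -subr_ge0 tS ltW.
  have -> : t k.+1 <= l.
    by rewrite /t mulrCA ger_pMr// ler_pdivrMr// mul1r ler_nat.
  move=> /(_ isT isT).
  have := IH (ltnW kn); rewrite -tS; nra.
have tl : t n.+1 = l by rewrite /t mulrC divfK.
by have := step n.+1 (leqnn _); rewrite tube0 tl (mulrC (cap _ _ _)).
Qed.

End tube.
End unit_speed.

(** * Unique projection makes ball traces connected *)

Lemma lipschitz_continuous (R : realType) (f : R -> R) (k : R) :
  (forall x y, `|f x - f y| <= k * `|x - y|) -> continuous f.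
Proof.
move=> fk x; apply/cvgrPdist_lt => e e0; near=> y.
have k1 : 0 < `|k| + 1 by rewrite ltr_wpDl.
apply: le_lt_trans (fk x y) _.
apply: (@le_lt_trans _ _ ((`|k| + 1) * `|x - y|)).
  by rewrite ler_wpM2r// (le_trans (ler_norm k))// lerDl.
rewrite mulrC -ltr_pdivlMr//.
by near: y; apply: cvgr_dist_lt => //; rewrite divr_gt0.
Unshelve. all: by end_near. Qed.

Section unique_projection.
Context {R : realType} {d : nat} (g : R -> 'rV[R]_d) (l r : R).
Hypothesis l_ge0 : 0 <= l.
Hypothesis g_lip : forall s t : R, s \in `[0, l] -> t \in `[0, l] ->
  enorm (g t - g s) <= `|t - s|.

(* Continued by constants outside [[0, l]], the curve is Lipschitz, hence continuous,
   on the whole line. *)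
Let clamp (t : R) : R := Num.max 0 (Num.min t l).

Let clamp_itv t : clamp t \in `[0, l].
Proof.
by rewrite in_itv/= /clamp le_max lexx/= ge_max l_ge0 ge_min lexx orbT.
Qed.

Let clamp_id t : t \in `[0, l] -> clamp t = t.
Proof. by rewrite in_itv/= /clamp => /andP[t0 tl]; rewrite min_l// max_r. Qed.

Let clamp_lip s t : `|clamp t - clamp s| <= `|t - s|.
Proof.
have clampP u : [\/ u < 0 /\ clamp u = 0, [/\ 0 <= u, u <= l & clamp u = u] |
    l < u /\ clamp u = l].
  rewrite /clamp; have [u0|u0] := ltP u 0.
    by apply: Or31; split=> //; rewrite min_l ?max_l// ?(ltW u0) ?(le_trans (ltW u0)).
  have [ul|lu] := leP u l; first by apply: Or32; split=> //; rewrite max_r.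
  by apply: Or33; split=> //; rewrite max_r.
have := ler_norm (t - s); have := ler_norm (s - t); rewrite (distrC s t) ler_norml.
have := l_ge0.
case: (clampP t) => [[? ->]|[? ? ->]|[? ->]];
  by case: (clampP s) => [[? ->]|[? ? ->]|[? ->]] *; apply/andP; split; lra.
Qed.

Let G t := g (clamp t).

Let G_lip s t : enorm (G t - G s) <= `|t - s|.
Proof. exact: le_trans (g_lip _ _ (clamp_itv s) (clamp_itv t)) (clamp_lip s t). Qed.

Lemma curve_image (a b : R) : 0 <= a -> b <= l -> g @` `[a, b] = G @` `[a, b].
Proof.
move=> a0 bl; apply: eq_imagel => t; rewrite /= in_itv/= => /andP[at_ tb].
by rewrite /G clamp_id// in_itv/= (le_trans a0)//= (le_trans tb).
Qed.

Let G_continuous : continuous (G : R -> 'rV[R]_d).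
Proof.
move=> t; apply/cvgrPdist_le => e e0; near=> u.
apply: (@le_trans _ _ (enorm (G t - G u))).
  rewrite [leLHS]/Num.norm/= mx_normrE; apply: bigmax_le; first exact: enorm_ge0.
  by move=> [i j] _ /=; rewrite (ord1 i); exact: coord_le_enorm.
apply: le_trans (G_lip u t) _.
by near: u; apply: cvgr_dist_le.
Unshelve. all: by end_near. Qed.

Lemma curve_compact : compact (g @` `[0, l]).
Proof.
rewrite curve_image//; apply: continuous_compact; last exact: segment_compact.
exact: continuous_subspaceT.
Qed.

Lemma curve_connected : connected (g @` `[0, l]).
Proof.
rewrite curve_image//; apply: connected_continuous_connected.
  exact: segment_connected.
exact: continuous_subspaceT.
Qed.

Lemma dist_attained p a b : 0 <= a -> a <= b -> b <= l ->
  exists2 t, a <= t <= b & enorm (p - g t) = dist p (g @` `[a, b]).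
Proof.
move=> a0 ab bl; rewrite curve_image//.
have cont : continuous (fun t => enorm (p - G t)).
  apply: (lipschitz_continuous _ _ 1) => x y; rewrite mul1r.
  have := enorm_triangle p (G y) (G x); have := enorm_triangle p (G x) (G y).
  have := G_lip x y; have := G_lip y x; rewrite (distrC y x) (enormB (G x)) ler_norml; lra.
have [t tab tmin] := EVT_min ab (continuous_subspaceT cont).
move: (tab); rewrite in_itv/= => /andP[at_ tb].
exists t; first by rewrite at_ tb.
have -> : g t = G t by rewrite /G clamp_id// in_itv/= (le_trans a0)//= (le_trans tb).
apply/eqP; rewrite eq_le; apply/andP; split; last by apply: dist_le; exists t.
apply: lb_le_inf; first by exists (enorm (p - G t)), (G t) => //; exists t.
by move=> _ [_ [u uab <-] <-]; exact: tmin.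
Qed.

Hypothesis unique_nearest : forall p, nbhd (g @` `[0, l]) r p ->
  exists! t : R, (0 <= t <= l) /\ enorm (p - g t) = dist p (g @` `[0, l]).

Let line p q (u : R) : 'rV[R]_d := p + u *: (q - p).

Let dist_line_lip p q A : A !=set0 -> forall x y,
  `|dist (line p q x) A - dist (line p q y) A| <= enorm (q - p) * `|x - y|.
Proof.
move=> A0 x y.
have lineB u v : enorm (line p q u - line p q v) = enorm (q - p) * `|u - v|.
  by rewrite mulrC -enormZ /line opprD addrACA subrr add0r -scalerBl.
have := dist_lip (line p q x) (line p q y) A A0.
have := dist_lip (line p q y) (line p q x) A A0.
rewrite !lineB (distrC y x) ler_norml.
by move: (dist _ A) (dist _ A) (_ * _) => D1 D2 e; lra.
Qed.

(** If a parameter [b] separates the parameter nearest to [p] from [t'], then on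
    the way from [p] to [g t'] some point has its nearest points both before and
    after [b]; by uniqueness they are [b] itself. *)
Lemma nearest_crosses p b t0 t' : 0 <= b <= l -> 0 <= t' <= l ->
  (t0 <= b <= t' \/ t' <= b <= t0) -> 0 <= t0 <= l ->
  enorm (p - g t0) = dist p (g @` `[0, l]) -> enorm (p - g t') < r ->
  exists2 u, 0 <= u <= 1 &
    enorm (line p (g t') u - g b) <= enorm (line p (g t') u - g t').
Proof.
move=> /andP[b0 bl] /andP[t'0 t'l] sep /andP[t00 t0l] t0near t'r.
pose A1 := g @` `[0, b]; pose A2 := g @` `[b, l].
have A10 : A1 !=set0 by exists (g 0), 0; rewrite //= in_itv/= lexx.
have A20 : A2 !=set0 by exists (g l), l; rewrite //= in_itv/= lexx bl.
pose k u := dist (line p (g t') u) A1 - dist (line p (g t') u) A2.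
have k_cont : continuous k.
  apply: (lipschitz_continuous _ _ (2 * enorm (g t' - p))) => x y.
  have sub4 (a1 a2 b1 b2 : R) : a1 - a2 - (b1 - b2) = a1 - b1 - (a2 - b2) by ring.
  rewrite /k sub4.
  apply: le_trans (ler_normB _ _) _; rewrite mulr_natl mulr2n mulrDl.
  by apply: lerD; exact: dist_line_lip.
have A1l x : A1 x -> (g @` `[0, l]) x.
  move=> [u /=]; rewrite in_itv/= => /andP[u0 ub] <-; exists u => //=.
  by rewrite in_itv/= u0 (le_trans ub).
have A2l x : A2 x -> (g @` `[0, l]) x.
  move=> [u /=]; rewrite in_itv/= => /andP[u0 ub] <-; exists u => //=.
  by rewrite in_itv/= ub (le_trans b0).
have dist_sub q A : A !=set0 -> (forall x, A x -> (g @` `[0, l]) x) ->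
    dist q (g @` `[0, l]) <= dist q A.
  move=> A0 Al; apply: lb_le_inf; first by have [] := has_inf_dist q A A0.
  by move=> _ [x Ax <-]; apply: dist_le; exact: Al.
have line0 : line p (g t') 0 = p by rewrite /line scale0r addr0.
have line1 : line p (g t') 1 = g t' by rewrite /line scale1r addrC subrK.
have dist_in q A : A q -> dist q A = 0.
  move=> Aq; apply/eqP; rewrite eq_le dist_ge0 andbT.
  by apply: le_trans (dist_le q q A Aq) _; rewrite subrr enorm0.
have [u u01 ku] : exists2 u, u \in `[0, 1] & k u = 0.
  apply: IVT => //; first exact: continuous_subspaceT.
  rewrite ge_min le_max /k line0 line1 !subr_le0 !subr_ge0.
  case: sep => /andP[ob bo].
    have -> : dist p A1 <= dist p A2.
      apply: le_trans (dist_sub p A2 A20 A2l); rewrite -t0near.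
      by apply: dist_le; exists t0 => //=; rewrite in_itv/= t00.
    have -> : dist (g t') A2 <= dist (g t') A1.
      by rewrite dist_in ?dist_ge0//; exists t' => //=; rewrite in_itv/= bo.
    by rewrite orbT.
  have -> : dist p A2 <= dist p A1.
    apply: le_trans (dist_sub p A1 A10 A1l); rewrite -t0near.
    by apply: dist_le; exists t0 => //=; rewrite in_itv/= bo.
  have -> : dist (g t') A1 <= dist (g t') A2.
    by rewrite dist_in ?dist_ge0//; exists t' => //=; rewrite in_itv/= t'0.
  by rewrite orbT.
have /andP[u0 u1] : 0 <= u <= 1 by rewrite in_itv in u01.
exists u; first by rewrite u0 u1.
set q := line p (g t') u.
have qt' : enorm (q - g t') = (1 - u) * enorm (p - g t').
  rewrite -[1 - u]ger0_norm ?subr_ge0// -enormZ; congr enorm.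
  by apply/rowP => i; rewrite !mxE; ring.
have q_nbhd : nbhd (g @` `[0, l]) r q.
  exists (g t'); first by exists t' => //=; rewrite in_itv/= t'0.
  rewrite /eball/= qt'; apply: le_lt_trans t'r.
  by rewrite ler_piMl ?enorm_ge0// gerBl.
have dist12 : dist q A1 = dist q A2 by apply/eqP; rewrite -subr_eq0; exact/eqP.
have distA : dist q A1 = dist q (g @` `[0, l]).
  apply/eqP; rewrite eq_le dist_sub// andbT.
  apply: lb_le_inf; first by exists (enorm (q - g 0)), (g 0) => //; exists 0; rewrite //= in_itv/= lexx.
  move=> _ [_ [v /= + <-] <-]; rewrite in_itv/= => /andP[v0 vl].
  have [vb|/ltW bv] := leP v b.
    by apply: dist_le; exists v => //=; rewrite in_itv/= v0.
  by rewrite dist12; apply: dist_le; exists v => //=; rewrite in_itv/= bv.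
have [t1 /andP[t10 t1b] t1near] := dist_attained q 0 b (lexx _) b0 bl.
have [t2 /andP[t2b t2l] t2near] := dist_attained q b l b0 bl (lexx _).
have [v [_ vuniq]] := unique_nearest q q_nbhd.
have v1 : v = t1 by apply: vuniq; rewrite t10 (le_trans t1b)//= t1near -distA.
have v2 : v = t2.
  by apply: vuniq; rewrite t2l (le_trans b0)//= t2near -/A2 -dist12 -distA.
have t1E : t1 = b by apply/eqP; rewrite eq_le t1b -v1 v2 t2b.
rewrite -t1E t1near -/A1 distA; apply: dist_le.
by exists t' => //=; rewrite in_itv/= t'0.
Qed.

(** With the nearest parameter [t0] on one side of [b], one of [a] and [c] lies on
    the other side. *)
Lemma ball_trace_connected s p a b c : s <= r ->
  0 <= a -> a <= b -> b <= c -> c <= l ->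
  eball p s (g a) -> eball p s (g c) -> eball p s (g b).
Proof.
move=> sr a0 ab bc cl; rewrite /eball/= !(enormB _ p) => pa pc.
have al := le_trans ab (le_trans bc cl).
have b0l : 0 <= b <= l by rewrite (le_trans a0)//= (le_trans bc).
have [t0 [[t0l t0near] _]] : exists! t : R, (0 <= t <= l) /\
    enorm (p - g t) = dist p (g @` `[0, l]).
  apply: unique_nearest; exists (g a); last exact: lt_le_trans pa sr.
  by exists a => //=; rewrite in_itv/= a0 (le_trans ab)// (le_trans bc).
have [t' [t'l [sep pt']]] : exists t', 0 <= t' <= l /\
    ((t0 <= b <= t' \/ t' <= b <= t0) /\ enorm (p - g t') < s).
  have [t0b|/ltW bt0] := leP t0 b.
    by exists c; rewrite cl (le_trans _ bc)//; [split=> //; split=> //; left|case/andP: b0l].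
  by exists a; rewrite a0 al; split=> //; split=> //; right; rewrite ab.
have [u /andP[u0 u1] qb] := nearest_crosses p b t0 t' b0l t'l sep t0l t0near (lt_le_trans pt' sr).
apply: le_lt_trans pt'.
apply: le_trans (enorm_triangle p (line p (g t') u) (g b)) _.
apply: le_trans (lerD (lexx _) qb) _.
have -> : p - line p (g t') u = u *: (p - g t').
  by apply/rowP => i; rewrite !mxE; ring.
have -> : line p (g t') u - g t' = (1 - u) *: (p - g t').
  by apply/rowP => i; rewrite !mxE; ring.
rewrite !enormZ !ger0_norm ?subr_ge0//; lra.
Qed.

End unique_projection.

(** * Trees joining overlapping sets *)

Section trees.
Context {R : realType} {d : nat}.
Implicit Types (x y q : 'rV[R]_d) (xs : seq 'rV[R]_d) (K : set 'rV[R]_d).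

(** Trees with straight edges of total length [L], built leaf by leaf so that an
    induction can charge the cost of each edge to its new leaf. *)
Inductive tree : seq 'rV[R]_d -> R -> Prop :=
| tree1 x : tree [:: x] 0
| treeS x y xs L : y \in xs -> tree xs L -> tree (x :: xs) (L + enorm (x - y)).

Section chain_of_sets.
Variables (I : finType) (U : I -> set 'rV[R]_d) (w : I -> R) (delta : R).
Hypothesis w_diam : forall i x y, U i x -> U i y -> enorm (x - y) <= w i.
Hypothesis w_ge0 : forall i, 0 <= w i.
Hypothesis w_le : forall i, w i <= delta.

Definition meets : rel I := [rel i j | `[< U i `&` U j !=set0 >]].

(** The outcome of growing a branch from a tree [xs] of length [L] to the point [q].
    The set [A] holds the newly used indices; the last clause, a lower bound on
    their total diameter by the distance bridged, will bound the number of
    branches. *)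
Definition branch (S : {set I}) xs L (k : I) p q := exists xs' L' (A : {set I}),
  [/\ tree xs' L', {subset xs <= xs'} & q \in xs'] /\
  [/\ forall i, i \in A -> i \notin S, {subset A <= k :: p},
      forall i, i \in A -> exists2 y, y \in xs' & U i y,
      L' <= L + \sum_(i in A) w i + delta &
      exists2 y, y \in xs & enorm (q - y) <= \sum_(i in A) w i + delta].

(** Following a simple path of overlapping sets, a vertex in each set costs at
    most the diameter of that set, because consecutive overlap points lie in a
    common set; attaching the branch inside an already used set costs [delta]. *)
Lemma tree_branch (S : {set I}) xs L k p q :
  tree xs L -> (forall i, i \in S -> exists2 y, y \in xs & U i y) ->
  path meets k p -> uniq (k :: p) -> last k p \in S -> U k q ->
  branch S xs L k p q.
Proof.
move=> tr Sxs.
move=> + + + Uq.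
have attach k' p' q' : k' \in S -> U k' q' -> branch S xs L k' p' q'.
  move=> /Sxs[y yxs Uy] Uq'.
  have qy : enorm (q' - y) <= delta by exact: le_trans (w_diam _ _ _ Uq' Uy) (w_le _).
  exists (q' :: xs), (L + enorm (q' - y)), finset.set0; split.
    by split; [exact: treeS|move=> z zxs; rewrite inE zxs orbT|exact: mem_head].
  rewrite big_set0 addr0 add0r lerD2l; split => //; last by exists y.
  1-3: by move=> i; rewrite inE.
elim: p k q Uq => [|k1 p IH] k q Uq; first by move=> _ _ /attach; exact.
move=> /= /andP[/asboolP[z [Uz Uz1]] kp] /andP[kn kpu] lastS.
have [kS|kS] := boolP (k \in S); first exact: attach.
have [xs1 [L1 [A [[tr1 sub1 z1] [dSA Ap AU L1le [y yxs zy]]]]]] :=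
  IH k1 z Uz1 kp kpu lastS.
have kA : k \notin A by apply: contra kn => /Ap.
have qz := w_diam _ _ _ Uq Uz.
exists (q :: xs1), (L1 + enorm (q - z)), (k |: A); split.
  by split; [exact: treeS|move=> t /sub1 txs; rewrite inE txs orbT|exact: mem_head].
rewrite big_setU1//=; split.
- by move=> i; rewrite !inE => /orP[/eqP->|/dSA].
- by move=> i; rewrite !inE => /orP[->//|/Ap]; rewrite inE => ->; rewrite orbT.
- move=> i; rewrite !inE => /orP[/eqP->|/AU[t txs Ut]].
    by exists q => //; exact: mem_head.
  by exists t => //; rewrite inE txs orbT.
- by move: L1le qz; lra.
- exists y => //; apply: le_trans (enorm_triangle q z y) _.
  by move: zy qz; lra.
Qed.

(** Greedy construction: as long as some set has a point farther than [h] from the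
    tree, grow a branch to it. Each branch uses up new sets of total diameter at
    least [h - delta]; this bounds the number [m] of branches and with it the total
    attachment cost [m%:R * delta]. *)
Lemma tree_meeting_far_sets (D : {set I}) (s0 : I) (x0 : 'rV[R]_d) (h : R) :
  delta < h -> U s0 x0 ->
  (forall k, k \in D -> connect meets k s0) ->
  exists xs L (m : nat),
  [/\ tree xs L, L <= \sum_i w i + m%:R * delta,
      m%:R * (h - delta) <= \sum_i w i &
      forall k x, k \in D -> U k x -> exists2 y, y \in xs & enorm (x - y) <= h].
Proof.
move=> dh Ux0 Dconn.
have sumS (S : {set I}) : \sum_(i in S) w i <= \sum_i w i.
  by rewrite [leRHS](bigID (mem S))/= lerDl sumr_ge0.
match goal with |- ?G => set target := G end.
(* [S] collects the sets that have been paid for, [m] counts the branches. *)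
suff grow n (S : {set I}) xs L (m : nat) : (#|~: S| < n)%N -> s0 \in S -> tree xs L ->
    L <= \sum_(i in S) w i + m%:R * delta -> m%:R * (h - delta) <= \sum_(i in S) w i ->
    (forall i, i \in S -> exists2 y, y \in xs & U i y) -> target.
  apply: (grow _ (finset.set1 s0) [:: x0] 0 0%N (ltnSn _)).
  - by rewrite inE.
  - exact: tree1.
  - by rewrite mul0r addr0 sumr_ge0.
  - by rewrite mul0r sumr_ge0.
  - by move=> i; rewrite inE => /eqP ->; exists x0 => //; exact: mem_head.
elim: n S xs L m => // n IH S xs L m cS s0S tr Lle mle Sxs.
have [[k [q [kD Uq far]]]|nfar] := pselect (exists k q, [/\ k \in D, U k q &
    forall y, y \in xs -> h < enorm (q - y)]); last first.
  exists xs, L, m; split => //.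
  - by apply: le_trans Lle _; rewrite lerD2r.
  - exact: le_trans mle (sumS S).
  - move=> k x kD Ux; apply: contrapT => nx; apply: nfar; exists k, x; split=> // y yxs.
    by rewrite ltNge; apply/negP => xy; apply: nx; exists y.
have /connectP[p0 p0path s0E] := Dconn k kD.
case/shortenP: p0path s0E => p pp pu _ s0E.
have lS : last k p \in S by rewrite -s0E.
have [xs' [L' [A [[tr' sub' q'] [dSA Ap AU L'le [y yxs qy]]]]]] :=
  tree_branch S xs L k p q tr Sxs pp pu lS Uq.
have hA : h - delta <= \sum_(i in A) w i.
  by have := far y yxs; move: qy; lra.
have A0 : A != finset.set0.
  apply/eqP => A0; move: hA; rewrite A0 big_set0; lra.
have SA : \sum_(i in S :|: A) w i = \sum_(i in S) w i + \sum_(i in A) w i.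
  rewrite (big_setID S)/= finset.setUK finset.setDUl finset.setDv finset.set0U.
  suff -> : A :\: S = A by [].
  apply/setP => i; rewrite !inE.
  by case: (boolP (i \in A)) => [/dSA->|]; rewrite ?andbF.
apply: (IH (S :|: A) xs' L' m.+1) => //.
- rewrite ltnS in cS; apply: leq_trans cS; apply: proper_card.
  rewrite finset.setCU; apply/properP; split; first exact: finset.subsetIl.
  have [AE|[i iA]] := set_0Vmem A; first by rewrite AE eqxx in A0.
  by exists i; rewrite ?inE ?dSA// iA andbF.
- by rewrite inE s0S.
- by rewrite SA -natr1; move: L'le Lle; lra.
- by rewrite SA -natr1; move: mle hA; lra.
- move=> i; rewrite inE => /orP[/Sxs[z zxs Uz]|/AU//].
  by exists z => //; exact: sub'.
Qed.

End chain_of_sets.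
End trees.

(** * Approximating continua by trees *)

Section continuum.
Context {R : realType} {d : nat}.
Implicit Types (x y q : 'rV[R]_d) (xs : seq 'rV[R]_d) (K T : set 'rV[R]_d).

Lemma le_diam T x y : T x -> T y -> ((enorm (x - y))%:E <= diam T)%E.
Proof.
by move=> Tx Ty; apply: ereal_sup_ubound; right; exists (x, y).
Qed.

Lemma diam_ge0 T : (0 <= diam T)%E.
Proof. by apply: ereal_sup_ubound; left. Qed.

(** Otherwise the union of the sets linked to [V i] would cut out a proper subset of
    [K] that is both open and closed in [K]. *)
Lemma connected_cover_connect (I : finType) (V : I -> set 'rV[R]_d) K i j :
  connected K -> (forall k, open (V k)) -> K `<=` \bigcup_k V k ->
  V i `&` K !=set0 -> V j `&` K !=set0 -> connect (meets I V) i j.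
Proof.
move=> cK oV KV [x [Vx Kx]] [y [Vy Ky]].
pose O1 := \bigcup_(k in [set k | connect (meets I V) i k]) V k.
pose O2 := \bigcup_(k in [set k | ~~ connect (meets I V) i k]) V k.
have O12 z : O1 z -> O2 z -> False.
  move=> [k ik Vk] [k' ik' Vk']; apply/negP: ik'; rewrite /= negbK.
  apply: connect_trans ik _; apply: connect1; apply/asboolP; by exists z.
have K1 : K `&` O1 = K.
  apply: cK; first by exists x; split => //; exists i => //=; exact: connect0.
    by exists O1 => //; exact: bigcup_open.
  exists (~` O2); first by apply: open_closedC; exact: bigcup_open.
  apply/seteqP; split=> z [Kz Oz]; split => //; first by move=> /(O12 z Oz).
  have [k _ Vkz] := KV z Kz; exists k => //=; apply: contrapT => ik; apply: Oz.
  by exists k => //=; exact/negP.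
have [_ [k ik Vky]] : (K `&` O1) y by rewrite K1.
by apply: connect_trans ik _; apply: connect1; apply/asboolP; exists y.
Qed.

Lemma sum_half (c : R) n : \sum_(i < n) (c / 2 ^+ i.+1) = c - c / 2 ^+ n.
Proof.
elim: n => [|n IH]; first by rewrite big_ord0 expr0 divr1 subrr.
rewrite big_ord_recr/= IH exprS; field; rewrite expf_neq0//.
Qed.

(** Length-efficient finite cover: enlarging the sets of an almost optimal cover
    slightly makes them open without spoiling the total diameter. *)
Lemma hausdorff1_open_cover K (l e delta : R) : compact K ->
  (hausdorff1 K <= l%:E)%E -> 0 < e -> 0 < delta ->
  exists (n : nat) (V : 'I_n -> set 'rV[R]_d) (w : 'I_n -> R),
  [/\ K `<=` \bigcup_i V i, (forall i, open (V i)),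
      (forall i x y, V i x -> V i y -> enorm (x - y) <= w i),
      (forall i, 0 <= w i <= delta) & \sum_i w i <= l + e].
Proof.
move=> cK Kl e0 delta0.
have : (hausdorff1_pre (delta / 2) K < (l + e / 2)%:E)%E.
  apply: (@le_lt_trans _ _ (l%:E)); last by rewrite lte_fin ltrDl divr_gt0.
  apply: le_trans Kl; apply: ereal_sup_ubound; exists (delta / 2) => //=.
  by rewrite divr_gt0.
move=> /ereal_inf_lt[_ [U [KU Udelta] <-] Ul].
pose c := Num.min (e / 2) (delta / 2).
have c0 : 0 < c by rewrite lt_min !divr_gt0.
pose eta (i : nat) : R := c / 2 ^+ i.+1 / 2.
have eta0 i : 0 < eta i by rewrite !divr_gt0// exprn_gt0.
have Ufin i : diam (U i) \is a fin_num.
  by rewrite ge0_fin_numE ?diam_ge0// (le_lt_trans (Udelta i))// ltry.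
pose V i := nbhd (U i) (eta i).
pose w i : R := fine (diam (U i)) + 2 * eta i.
have w_diam i x y : V i x -> V i y -> enorm (x - y) <= w i.
  move=> [x' Ux' xx'] [y' Uy' yy'].
  have xy' : enorm (x' - y') <= fine (diam (U i)).
    by rewrite -lee_fin fineK// le_diam.
  have h1 := enorm_triangle x x' y; have h2 := enorm_triangle x' y' y.
  move: xx' yy'; rewrite /eball/= (enormB y y') /w => h3 h4.
  lra.
have [] := (_ : cover_compact K) nat setT V.
- by rewrite -compact_cover.
- by move=> i _; exact: open_nbhd.
- by move=> x /KU[i _ Ux]; exists i => //; exact: sub_nbhd.
move=> D _ KD.
pose n := (\max_(i <- finmap.enum_fset D) i).+1.
exists n, (fun i : 'I_n => V i), (fun i : 'I_n => w i); split.
- move=> x /KD[i /= iD Vx]; have i_n : (i < n)%N by rewrite ltnS; exact: leq_bigmax_seq.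
  by exists (Ordinal i_n).
- by move=> i; exact: open_nbhd.
- by move=> i; exact: w_diam.
- move=> i; rewrite /w; apply/andP; split.
    by rewrite addr_ge0 ?fine_ge0 ?diam_ge0 ?mulr_ge0// ltW.
  rewrite [leRHS]splitr lerD//; first by rewrite -lee_fin fineK.
  rewrite mulrC divfK// (@le_trans _ _ c)//; last by rewrite ge_min lexx orbT.
  by rewrite ler_pdivrMr ?exprn_gt0// ler_peMr ?(ltW c0)// exprn_ege1// ler1n.
- rewrite big_split/= (splitr e) addrA lerD//.
  + rewrite -lee_fin; apply: le_trans (ltW Ul).
    rewrite -sumEFin; under eq_bigr do rewrite fineK//.
    rewrite -(big_mkord xpredT (fun i => diam (U i))).
    by apply: nneseries_lim_ge => i _ _; exact: diam_ge0.
  + under eq_bigr do rewrite mulrC divfK//.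
    rewrite sum_half; apply: (@le_trans _ _ c); last by rewrite ge_min lexx.
    by rewrite gerBl divr_ge0 ?ltW ?exprn_gt0.
Qed.

(** The greedy tree for a length-efficient cover at scale [delta] is longer than the
    total diameter of the cover only by the attachment costs, and these vanish when
    [delta] is small compared with the scale [h] of the approximation. *)
Lemma continuum_tree K (l e : R) : K !=set0 -> compact K -> connected K ->
  (hausdorff1 K <= l%:E)%E -> 0 <= l -> 0 < e ->
  exists xs L, [/\ tree xs L, L <= l + e & K `<=` nbhd [set` xs] e].
Proof.
move=> [x0 Kx0] cK coK Kl l0 e0.
pose W := l + e / 2.
have W0 : 0 < W by rewrite ltr_wpDl// divr_gt0.
pose h := e / 2.
have h0 : 0 < h by rewrite divr_gt0.
(* This makes [delta] small compared with both [h] and the error left for the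
   at most [W / (h - delta)] branches. *)
have hW0 : 0 < h + W by exact: addr_gt0.
pose delta := h * h / (h + W).
have delta0 : 0 < delta by apply: divr_gt0 => //; exact: mulr_gt0.
have dh : delta < h by rewrite /delta ltr_pdivrMr// ltr_pM2l// ltrDl.
have [n [V [w [KV oV w_diam w_itv wW]]]] := hausdorff1_open_cover K l (e / 2) delta
  cK Kl h0 delta0.
have [s0 _ Vx0] := KV x0 Kx0.
pose D : {set 'I_n} := [set i | `[< V i `&` K !=set0 >]]%SET.
have [] := @tree_meeting_far_sets R d _ V w delta w_diam _ _ D s0 x0 h dh Vx0.
- by move=> i; case/andP: (w_itv i).
- by move=> i; case/andP: (w_itv i).
- move=> k; rewrite inE => /asboolP Vk; apply: connected_cover_connect coK oV KV Vk _.
  by exists x0.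
move=> xs [L [m [tr Lle mle near]]]; exists xs, L; split=> //.
- apply: le_trans Lle _; rewrite (splitr e) addrA; apply: lerD => //.
  rewrite -/W -/h in wW *.
  have mW := le_trans mle wW.
  have hd : h - delta = h * W / (h + W).
    by rewrite /delta; field; rewrite gt_eqF.
  move: mW; rewrite hd mulrA ler_pdivrMr// mulrA (mulrC W) ler_pM2r// => mh.
  by rewrite /delta mulrA ler_pdivrMr// mulrA mulrC ler_pM2l//.
- move=> x Kx; have [k _ Vk] := KV x Kx.
  have [|y yxs xy] := near k x _ Vk; first by rewrite inE; apply/asboolP; exists x.
  exists y => //=; rewrite /eball/=; apply: le_lt_trans xy _.
  by rewrite /h ltr_pdivrMr// ltr_pMr// ltr1n.
Qed.

End continuum.

(** * Comparing neighbourhoods of the curve and of a competitor *)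

Section tree_volume.
Context {R : realType} {d : nat}.
Implicit Types (xs : seq 'rV[R]_d) (K : set 'rV[R]_d).

Lemma nbhd_cons x xs s : nbhd [set` x :: xs] s = eball x s `|` nbhd [set` xs] s.
Proof.
rewrite -nbhd1 -nbhdU; congr nbhd; apply/seteqP; split=> y /=; rewrite inE.
  by move=> /orP[/eqP->|]; [left|right].
by move=> [->|->]; rewrite ?eqxx// orbT.
Qed.

Lemma bounded_borel_nbhd_seq xs s : bounded_borel (nbhd [set` xs] s).
Proof.
elim: xs => [|x xs IH]; last first.
  by rewrite nbhd_cons; apply: bounded_borelU => //; exact: bounded_borel_eball.
by apply: (bounded_borel_nbhd _ _ 0) => x /=.
Qed.

Lemma vol_tree xs L s (c : R) : tree xs L ->
  (forall p q : 'rV[R]_d, cap s p q <= c * enorm (q - p)) ->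
  vol (nbhd [set` xs] s) <= vol (eball (0 : 'rV[R]_d) s) + c * L.
Proof.
move=> + capc; elim=> {xs L} [x|x y xs L yxs _ IH].
  rewrite mulr0 addr0 (_ : [set` [:: x]] = [set x]) ?nbhd1 ?vol_eball//.
  by apply/seteqP; split=> y /=; rewrite inE => /eqP.
have bb := bounded_borel_eball; have bN := bounded_borel_nbhd_seq.
have bD : bounded_borel (eball x s `\` eball y s) by exact: bounded_borelD.
rewrite mulrDr addrA; apply: le_trans (lerD IH (capc y x)).
apply: le_trans (volU_le _ _ (bN xs s) bD).
apply: le_vol; [by have [] := bN (x :: xs) s|exact: bounded_borelU|].
rewrite nbhd_cons => z [zx|zxs]; last by left.
have [zy|zy] := pselect (eball y s z); last by right.
by left; exists y.
Qed.

(** Passage to the limit in [vol_tree]: the radius gained from [s] to [s'] absorbs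
    the distance between the continuum and the approximating tree. *)
Lemma vol_continuum K (l c s s' : R) : K !=set0 -> compact K -> connected K ->
  (hausdorff1 K <= l%:E)%E -> 0 <= l -> 0 <= c -> s < s' ->
  (forall p q : 'rV[R]_d, cap s' p q <= c * enorm (q - p)) ->
  vol (nbhd K s) <= vol (eball (0 : 'rV[R]_d) s') + c * l.
Proof.
move=> K0 cK coK Kl l0 c0 ss' capc; apply/ler_addgt0Pr => e e0.
pose e' := Num.min (s' - s) (e / (c + 1)).
have c1 : 0 < c + 1 by rewrite ltr_wpDl.
have e'0 : 0 < e' by rewrite lt_min subr_gt0 ss' divr_gt0.
have [xs [L [tr Ll Kxs]]] := continuum_tree K l e' K0 cK coK Kl l0 e'0.
have Ks : nbhd K s `<=` nbhd [set` xs] s'.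
  apply: (subset_trans (nbhdS _ _ s Kxs)); apply: (subset_trans (nbhd_nbhd _ _ _)).
  by apply: le_nbhd; rewrite -lerBrDr ge_min lexx.
apply: le_trans (_ : vol (nbhd [set` xs] s') <= _).
  by apply: le_vol => //; [exact: measurable_nbhd|exact: bounded_borel_nbhd_seq].
apply: le_trans (vol_tree xs L s' c tr capc) _.
rewrite -addrA lerD2l; apply: (@le_trans _ _ (c * (l + e'))); first exact: ler_wpM2l.
rewrite mulrDr lerD2l; apply: (@le_trans _ _ (c * (e / (c + 1)))).
  by apply: ler_wpM2l => //; rewrite ge_min lexx orbT.
by rewrite mulrCA ger_pMr// ler_pdivrMr// mul1r lerDl.
Qed.

End tree_volume.

Lemma invn_small {R : realType} (e : R) : 0 < e -> exists n : nat, n.+1%:R^-1 < e.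
Proof.
move=> e0; have /archi_boundP : 0 <= e^-1 by rewrite invr_ge0 ltW.
set n := Num.bound _ => en; exists n.
rewrite invf_plt ?posrE//; apply: lt_le_trans en _; by rewrite ler_nat.
Qed.

Lemma measurable_dist (R : realType) (d : nat) (A : set 'rV[R]_d) : A !=set0 ->
  measurable_fun setT (fun x : borel_rV d => dist x A).
Proof.
move=> A0; apply: (measurability _ (@RGenCInfty.measurableE R)) => // _ [_ [a ->] <-].
rewrite setTI (_ : _ @^-1` _ = ~` nbhd A a).
  by apply: measurableC; exact: measurable_nbhd.
apply/seteqP; split=> x /=; rewrite in_itv/= andbT.
  by move=> ax /(dist_lt _ _ _ A0); rewrite ltNge ax.
by move=> nx; rewrite leNgt; apply/negP => /(dist_lt _ _ _ A0).
Qed.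

Section comparison.
Context {R : realType} {d : nat} (g : R -> 'rV[R]_d) (l r : R).
Hypothesis l_gt0 : 0 < l.
Hypothesis unit_speed : forall s t : R, 0 <= s -> s <= t -> t <= l ->
  curve_length s t g = (t - s)%:E.
Let Gamma : set 'rV[R]_d := g @` `[0, l].
Hypothesis unique_nearest : forall p, nbhd Gamma r p ->
  exists! t : R, (0 <= t <= l) /\ enorm (p - g t) = dist p Gamma.

Let bounded_Gamma s : bounded_borel (nbhd Gamma s).
Proof. exact: bounded_borel_nbhd (arc_bounded g l l_gt0 unit_speed l (lexx l)). Qed.

Let Gamma0 : Gamma !=set0.
Proof. by exists (g 0), 0; rewrite //= in_itv/= lexx ltW. Qed.

Variable beta : set 'rV[R]_d.
Hypothesis beta0 : beta !=set0.
Hypothesis beta_compact : compact beta.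
Hypothesis beta_connected : connected beta.
Hypothesis beta_length : (hausdorff1 beta <= l%:E)%E.

(** The slope [c] is chosen so that [V + c * l] is the volume of the tube around the
    whole curve. *)
Lemma vol_nbhd_lt (s s' : R) : s < s' -> s' <= r ->
  vol (nbhd beta s) <= vol (nbhd Gamma s').
Proof.
move=> ss' s'r; set V := vol (eball (0 : 'rV[R]_d) s').
have trace := ball_trace_connected g l r (ltW l_gt0)
  (chord_norm_le g l unit_speed) unique_nearest s'.
have slope p q := tube_slope g l l_gt0 unit_speed s'
  (fun p a b c => trace p a b c s'r) p q.
pose c := (vol (nbhd Gamma s') - V) / l.
have c0 : 0 <= c.
  apply: divr_ge0; last exact: ltW.
  rewrite subr_ge0 /V -(tube0 g).
  exact: (le_tube g l l_gt0 unit_speed s' (fun p a b c => trace p a b c s'r) 0 l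
    (lexx _) (ltW l_gt0) (lexx _)).
have -> : vol (nbhd Gamma s') = V + c * l by rewrite divfK ?gt_eqF// addrC subrK.
apply: (vol_continuum beta l c s s') => //; first exact: ltW.
move=> p q; rewrite /c mulrAC ler_pdivlMr// mulrC (mulrC _ (enorm _)).
exact: slope.
Qed.

Lemma bounded_beta s : bounded_borel (nbhd beta s).
Proof.
have [xs [L [_ _ bxs]]] := continuum_tree beta l 1 beta0 beta_compact
  beta_connected beta_length (ltW l_gt0) ltr01.
apply: (bounded_borelS _ (nbhd [set` xs] (1 + s))).
- exact: measurable_nbhd.
- exact: subset_trans (nbhdS _ _ s bxs) (nbhd_nbhd _ _ _).
- exact: bounded_borel_nbhd_seq.
Qed.

Lemma measure_nbhd_lt (s s' : R) : s < s' -> s' <= r ->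
  (lebesgue_rV d (nbhd beta s) <= lebesgue_rV d (nbhd Gamma s'))%E.
Proof.
by move=> ss' s'r; rewrite -!volK ?lee_fin ?vol_nbhd_lt//; exact: bounded_beta.
Qed.

(** The loss of radius disappears by continuity of the measure from below. *)
Lemma measure_nbhd (s : R) : s <= r ->
  (lebesgue_rV d (nbhd beta s) <= lebesgue_rV d (nbhd Gamma s))%E.
Proof.
move=> sr; pose F n : set (borel_rV d) := nbhd beta (s - n.+1%:R^-1).
have FE : nbhd beta s = \bigcup_n F n.
  apply/seteqP; split=> [x [y by_ yx]|x [n _]]; last first.
    by apply: le_nbhd; rewrite gerBl invr_ge0.
  have [n ne] := invn_small (s - enorm (x - y)) ltac:(by rewrite subr_gt0).
  by exists n => //; exists y => //; rewrite /eball/= ltrBrDr addrC -ltrBrDr.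
have mF n : measurable (F n) by exact: measurable_nbhd.
have ndF : nondecreasing_seq F.
  move=> m n mn; apply/subsetPset; apply: le_nbhd.
  by rewrite lerD2l lerN2 lef_pV2 ?posrE// ler_nat.
have cF := @nondecreasing_cvg_mu _ _ _ (lebesgue_rV d) F mF (bigcupT_measurable _ mF) ndF.
rewrite FE -(cvg_lim _ cF)//; apply: lime_le; first by apply/cvg_ex; exists (lebesgue_rV d (\bigcup_n F n)).
by near=> n; apply: measure_nbhd_lt => //; rewrite ltrBlDr ltrDl.
Unshelve. all: by end_near. Qed.

(** Likewise by continuity from above; the radii [s + a n] stay below [r]. *)
Lemma measure_nbhd_closed (s : R) : s < r ->
  (lebesgue_rV d [set x | (dist x beta <= s)%R] <=
   lebesgue_rV d [set x | (dist x Gamma <= s)%R])%E.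
Proof.
move=> sr; pose a n : R := (r - s) / n.+1%:R.
have a0 n : 0 < a n by rewrite divr_gt0// subr_gt0.
pose F n : set (borel_rV d) := nbhd Gamma (s + a n).
have FE : [set x | dist x Gamma <= s] = \bigcap_n F n.
  apply/seteqP; split=> [x /= xs n _|x Fx].
    by apply/dist_lt => //; apply: le_lt_trans xs _; rewrite ltrDl.
  apply/ler_addgt0Pr => e e0.
  have [n ne] := invn_small (e / (r - s)) ltac:(by rewrite divr_gt0// subr_gt0).
  have /(dist_lt _ _ _ Gamma0)/ltW := Fx n I; move/le_trans; apply.
  by rewrite lerD2l /a mulrC -ler_pdivlMr ?subr_gt0// ltW.
have mF n : measurable (F n) by exact: measurable_nbhd.
have niF : nonincreasing_seq F.
  move=> m n mn; apply/subsetPset; apply: le_nbhd.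
  by rewrite lerD2l ler_pM2l ?subr_gt0// lef_pV2 ?posrE// ler_nat.
have F0 : (lebesgue_rV d (F 0%N) < +oo)%E.
  by rewrite -ge0_fin_numE//; exact: vol_fin_num _ (bounded_Gamma _).
have cF := @nonincreasing_cvg_mu _ _ _ (lebesgue_rV d) F F0 mF (bigcapT_measurable mF) niF.
rewrite FE -(cvg_lim _ cF)//; apply: lime_ge; first by apply/cvg_ex; exists (lebesgue_rV d (\bigcap_n F n)).
near=> n.
apply: le_trans (measure_nbhd_lt (s + a n / 2) (s + a n) _ _); last 2 first.
- by rewrite ltrD2l ltr_pdivrMr// ltr_pMr// ltr1n.
- by rewrite -lerBrDl ler_pdivrMr// ler_peMr ?ler1n// subr_ge0 ltW.
apply: le_measure; rewrite ?inE.
- rewrite (_ : [set _ | _] = (fun x => dist x beta) @^-1` `]-oo, s]).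
    by apply: measurable_preimage => //; exact: measurable_dist.
  by apply/seteqP; split=> x /=; rewrite in_itv.
- exact: measurable_nbhd.
- by move=> x /= xs; apply/dist_lt => //; apply: le_lt_trans xs _; rewrite ltrDl divr_gt0.
Unshelve. all: by end_near. Qed.

End comparison.

(** * From neighbourhoods to integrals *)

Section sublevel.
Context {R : realType} {d : nat}.
Variables (Gamma beta : set 'rV[R]_d) (r : R) (phi : R -> R).
Hypothesis phi_nd : forall x y : R, 0 <= x -> x <= y -> phi x <= phi y.
Hypotheses (Gamma0 : Gamma !=set0) (beta0 : beta !=set0).
Hypothesis nbhd_le : forall s, s <= r ->
  (lebesgue_rV d (nbhd beta s) <= lebesgue_rV d (nbhd Gamma s))%E.
Hypothesis closed_nbhd_le : forall s, s < r ->
  (lebesgue_rV d [set x | (dist x beta <= s)%R] <=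
   lebesgue_rV d [set x | (dist x Gamma <= s)%R])%E.

Lemma measurable_phi_dist (A : set 'rV[R]_d) : A !=set0 ->
  measurable_fun setT (fun x : borel_rV d => phi (dist x A)).
Proof.
(* [phi] is monotone on nonnegative arguments only; [psi] continues it by a
   constant. *)
move=> A0; pose psi (x : R) := phi (Num.max x 0).
rewrite (_ : (fun _ => _) = psi \o (fun x => dist x A)); last first.
  by apply/funext => x; rewrite /psi/= max_l// dist_ge0.
have mpsi : measurable_fun setT psi.
  apply: nondecreasing_measurable => // x y xy; apply: phi_nd.
    by rewrite le_max lexx orbT.
  by rewrite ge_max !le_max xy lexx orbT.
exact: measurableT_comp mpsi (measurable_dist _ _ A A0).
Qed.

Let sublevel (A : set 'rV[R]_d) c : set (borel_rV d) :=
  nbhd Gamma r `&` [set x | phi (dist x A) <= c].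

Lemma measurable_sublevel A c : A !=set0 -> measurable (sublevel A c).
Proof.
move=> A0; apply: measurableI; first exact: measurable_nbhd.
rewrite (_ : [set _ | _] = (fun x => phi (dist x A)) @^-1` `]-oo, c]).
  by apply: measurable_preimage => //; exact: measurable_phi_dist.
by apply/seteqP; split=> x /=; rewrite in_itv.
Qed.

(** Inside [nbhd Gamma r], the sublevel set of a non-decreasing function of a
    distance is either everything, or cut out by a closed neighbourhood, or by an
    open one, according to whether the supremum [s] of the arguments with value at
    most [c] is attained. *)
Lemma measure_sublevel_le c :
  (lebesgue_rV d (sublevel beta c) <= lebesgue_rV d (sublevel Gamma c))%E.
Proof.
have mclosed (A : set 'rV[R]_d) (s : R) : A !=set0 ->
    measurable ([set x | dist x A <= s] : set (borel_rV d)).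
  move=> A0; rewrite (_ : [set _ | _] = (fun x => dist x A) @^-1` `]-oo, s]).
    by apply: measurable_preimage => //; exact: measurable_dist.
  by apply/seteqP; split=> x /=; rewrite in_itv.
have le_leb (A B : set (borel_rV d)) : measurable A -> measurable B -> A `<=` B ->
    (lebesgue_rV d A <= lebesgue_rV d B)%E.
  by move=> mA mB AB; apply: le_measure => //; rewrite inE.
have [all_le|] := pselect (forall u, 0 <= u -> u < r -> phi u <= c).
  apply: le_leb; [exact: measurable_sublevel|exact: measurable_sublevel|].
  move=> x [xr _]; split => //=; apply: all_le; first exact: dist_ge0.
  exact/dist_lt.
move=> /existsNP[u0 /not_implyP[u00 /not_implyP[u0r /negP]]]; rewrite -ltNge => cu0.
pose J := [set u | 0 <= u /\ phi u <= c].
have Ju0 u : J u -> u < u0.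
  move=> [u_ge0 uc]; rewrite ltNge; apply/negP => u0u.
  by have := lt_le_trans cu0 (phi_nd u0 u u00 u0u); rewrite ltNge uc.
have [[j Jj]|J0] := pselect (J !=set0); last first.
  rewrite (_ : sublevel beta c = set0) ?measure0//.
  rewrite -subset0 => x [_ xc]; apply: J0; exists (dist x beta).
  by split => //; exact: dist_ge0.
have supJ : has_sup J by split; [exists j|exists u0 => u /Ju0/ltW].
pose s := sup J.
have Js u : J u -> u <= s by move=> Ju; apply: ub_le_sup => //; case: supJ.
have su0 : s <= u0 by apply: ge_sup; [exists j|move=> u /Ju0/ltW].
have sr : s < r := le_lt_trans su0 u0r.
have betaJ x : sublevel beta c x -> J (dist x beta).
  by move=> [_ xc]; split=> //; exact: dist_ge0.
have [sc|cs] := leP (phi s) c.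
  apply: le_trans (le_trans _ (closed_nbhd_le s sr)) _; apply: le_leb.
  - exact: measurable_sublevel.
  - exact: mclosed.
  - by move=> x /betaJ/Js.
  - exact: mclosed.
  - exact: measurable_sublevel.
  - move=> x /= xs; split; first by apply/dist_lt => //; exact: le_lt_trans sr.
    by apply: le_trans sc; apply: phi_nd => //; exact: dist_ge0.
apply: le_trans (le_trans _ (nbhd_le s (ltW sr))) _; apply: le_leb.
- exact: measurable_sublevel.
- exact: measurable_nbhd.
- move=> x /betaJ Jx; apply/dist_lt => //; rewrite lt_neqAle Js// andbT.
  by apply/eqP => xs; case: Jx => _; rewrite xs leNgt cs.
- exact: measurable_nbhd.
- exact: measurable_sublevel.
- move=> x xs; split; first exact: le_nbhd (ltW sr) _ xs.
  have /(dist_lt _ _ _ Gamma0)/(sup_gt (ex_intro _ j Jj))[u [_ uc] xu] := xs.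
  by apply: le_trans uc; apply: phi_nd; [exact: dist_ge0|exact: ltW].
Qed.

Lemma measure_superlevel_le c : bounded_borel (nbhd Gamma r) ->
  (lebesgue_rV d (nbhd Gamma r `&` [set x | (c < phi (dist x Gamma))%R]) <=
   lebesgue_rV d (nbhd Gamma r `&` [set x | (c < phi (dist x beta))%R]))%E.
Proof.
move=> bG.
have superE (A : set 'rV[R]_d) : nbhd Gamma r `&` [set x | c < phi (dist x A)] =
    nbhd Gamma r `\` sublevel A c.
  apply/seteqP; split=> x [xr /=].
    by rewrite ltNge => /negP xc; split=> // -[].
  by move=> xc; split=> //=; rewrite ltNge; apply/negP => xc'; exact: xc.
have bS A : A !=set0 -> bounded_borel (sublevel A c).
  move=> A0; apply: bounded_borelS _ bG; first exact: measurable_sublevel.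
  exact: subIsetl.
have subI A : nbhd Gamma r `&` sublevel A c = sublevel A c.
  by rewrite setIA setIid.
rewrite !superE -!volK; [|by apply: bounded_borelD => //; exact: bS..].
rewrite lee_fin !volD// ?subI; [|exact: bS..].
by rewrite lerD2l lerN2 -lee_fin !volK ?measure_sublevel_le//; exact: bS.
Qed.

End sublevel.

(** Layer cake: by Cavalieri's principle applied to the region below the graph, an
    integral is the integral of the measures of the superlevel sets. *)
Lemma le_integral_superlevel d (T : measurableType d) (R : realType)
    (m : {sigma_finite_measure set T -> \bar R}) (D : set T) (f g : T -> R) :
  measurable D -> measurable_fun setT f -> measurable_fun setT g ->
  (forall x, 0 <= f x) -> (forall x, 0 <= g x) ->
  (forall t, (m (D `&` [set x | (t < f x)%R]) <= m (D `&` [set x | (t < g x)%R]))%E) ->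
  (\int[m]_(x in D) (f x)%:E <= \int[m]_(x in D) (g x)%:E)%E.
Proof.
move=> mD mf mg f0 g0 fg.
pose E (h : T -> R) : set (T * measurableTypeR R) :=
  [set p | D p.1 /\ 0 <= p.2 < h p.1].
have mE h : measurable_fun setT h -> measurable (E h).
  move=> mh; rewrite (_ : E h = fst @^-1` D `&` (snd @^-1` `[0, +oo[ `&`
      (fun p => h p.1 - p.2) @^-1` `]0, +oo[)).
    apply: measurableI; first exact: measurable_preimage measurable_fst mD.
    apply: measurableI; first by apply: measurable_preimage => //; exact: measurable_snd.
    apply: measurable_preimage => //; apply: measurable_funB.
      exact: measurableT_comp mh measurable_fst.
    exact: measurable_snd.
  apply/seteqP; split=> -[x t] /=; rewrite !in_itv/= !andbT subr_gt0.
    by move=> [Dx /andP[]].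
  by move=> [Dx [t0 tx]]; split=> //; apply/andP.
have layer (h : T -> R) : (forall x, 0 <= h x) -> measurable_fun setT h ->
    (\int[m]_(x in D) (h x)%:E = \int[lebesgue_measure]_t m (ysection (E h) t))%E.
  move=> h0 mh; rewrite -cavalieri; last exact: mE.
  rewrite integral_mkcond; apply: eq_integral => x _; rewrite patchE.
  case: ifPn => [/set_mem Dx|/negP Dx].
    rewrite (_ : xsection (E h) x = `[0, h x[%classic).
      rewrite [RHS]lebesgue_measure_itv/= lte_fin; case: ltP (h0 x) => // [_ _|hx0 hx].
        by rewrite -EFinD oppr0 addr0.
      by congr EFin; apply/le_anti/andP.
    apply/seteqP; split=> t; rewrite /xsection/= inE/= in_itv/=; first by case.
    by split.
  rewrite (_ : xsection (E h) x = set0) ?measure0// -subset0 => t.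
  by rewrite /xsection/= inE => -[/= Dx' _]; apply: Dx; exact/mem_set.
rewrite !layer//; apply: ge0_le_integral => //.
- by apply: measurable_fun_ysection => //; exact: mE.
- by apply: measurable_fun_ysection => //; exact: mE.
move=> t _; have [t0|t0] := leP 0 t.
  have secE h : ysection (E h) t = D `&` [set x | t < h x].
    by apply/seteqP; split=> x; rewrite /ysection/= inE /E/= t0.
  by rewrite !secE.
rewrite (_ : ysection (E f) t = set0) ?measure0// -subset0 => x.
by rewrite /ysection/= inE => -[/= _ /andP[]]; rewrite leNgt t0.
Qed.

Section sigma_finite.
Context {R : realType} (d : nat).

Let sigma_finite_lebesgue_rV : sigma_finite setT (@lebesgue_rV R d).
Proof.
exists (fun n : nat => eball (0 : 'rV[R]_d) n%:R : set (borel_rV d)).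
  by rewrite eball_bigcup.
move=> n; split; first exact: measurable_eball.
exact: lebesgue_rV_bounded (measurable_eball _ _) (@subset_refl _ _).
Qed.

HB.instance Definition _ := Measure_isSigmaFinite.Build _ _ _
  (@lebesgue_rV R d) sigma_finite_lebesgue_rV.

End sigma_finite.

Theorem theorem2p5 (R : realType) (d : nat) (Gamma : set 'rV[R]_d)
    (gamma : R -> 'rV[R]_d) (l r : R) :
  0 < l ->
  rectifiable_curve Gamma ->
  hausdorff1 Gamma = l%:E ->
  arc_length_parametrization Gamma gamma ->
  0 < r ->
  (forall p : 'rV[R]_d, nbhd Gamma r p ->
    exists! t : R, (0 <= t <= fine (hausdorff1 Gamma)) /\
      enorm (p - gamma t) = dist p Gamma) ->
  forall phi : R -> R,
    (forall x : R, 0 <= x -> 0 <= phi x) ->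
    (forall x y : R, 0 <= x -> x <= y -> phi x <= phi y) ->
    adm_solution phi (nbhd Gamma r) l Gamma.
Proof.
move=> l0 _ Gl [+ +] r0; rewrite Gl/= => GammaE unit_speed unique phi phi0 phi_nd.
have lip := chord_norm_le gamma l unit_speed.
have Gamma0 : Gamma !=set0.
  by rewrite GammaE; exists (gamma 0), 0; rewrite //= in_itv/= lexx ltW.
split.
  split => //; last by rewrite Gl.
  - by rewrite GammaE; exact: curve_compact (ltW l0) lip.
  - by rewrite GammaE; exact: curve_connected (ltW l0) lip.
  - exact: subset_trans (sub_nbhd _ _ r0) (@subset_closure _ _).
move=> beta [beta0 beta_compact beta_connected _ beta_length].
rewrite /average_distance; apply: le_integral_superlevel.
- exact: measurable_nbhd.
- exact: measurable_phi_dist.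
- exact: measurable_phi_dist.
- by move=> x; apply/phi0/dist_ge0.
- by move=> x; apply/phi0/dist_ge0.
move=> c; rewrite GammaE in unique *.
apply: measure_superlevel_le => //.
- by rewrite -GammaE.
- exact: measure_nbhd gamma l r l0 unit_speed unique beta beta0 beta_compact
    beta_connected beta_length.
- exact: measure_nbhd_closed gamma l r l0 unit_speed unique beta beta0 beta_compact
    beta_connected beta_length.
- exact: bounded_borel_nbhd (arc_bounded gamma l l0 unit_speed l (lexx l)).
Qed.
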